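(* Let $k$ be a field. The Knop-like measures for $\mathfrak{P}$ (the class of finite posets) valued in $k$ are exactly the measures $\nu$ whose matrix $N=(\nu(J_{p,q}\setminus\{\ast\}\to J_{p,q}))_{0\le p,q\le2}$ is one of $$\mathbb{B}_5(t)=\begin{pmatrix}t&-1&0\\-1&-1&0\\0&0&1\end{pmatrix}\ (t\in k),\quad \mathbb{C}_7=\begin{pmatrix}0&-1&0\\0&-1&0\\1&0&1\end{pmatrix},\quad \mathbb{C}_7^{\top},\quad \mathbb{C}_8=\begin{pmatrix}1&0&1\\0&-1&0\\1&0&1\end{pmatrix}.$$
   Context: All posets are finite; the empty poset is allowed. An embedding of posets is an injective map $\alpha\colon P\to Q$ with $x\le y\iff\alpha(x)\le\alpha(y)$. Given embeddings $\alpha\colon P\to Q$ and $\beta\colon P\to P'$, an amalgamation of $Q$ and $P'$ over $P$ is a triple $(Q',\alpha',\beta')$ where $Q'$ is a poset and $\alpha'\colon P'\to Q'$, $\beta'\colon Q\to Q'$ are embeddings with $\beta'\circ\alpha=\alpha'\circ\beta$ and $Q'=\mathrm{im}(\alpha')\cup\mathrm{im}(\beta')$; amalgamations are considered up to the evident notion of isomorphism. A measure for $\mathfrak{P}$ valued in $k$ is a rule $\nu$ assigning to each embedding $\alpha\colon P\to Q$ of finite posets a value $\nu(\alpha)\in k$ such that: (a) $\nu(\alpha)=1$ if $\alpha$ is an isomorphism; (b) $\nu(\beta\circ\alpha)=\nu(\beta)\nu(\alpha)$ when the composition is defined; (c) given embeddings $\alpha\colon P\to Q$ and $\beta\colon P\to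 P'$, with $(Q'_i,\alpha'_i,\beta'_i)$, $1\le i\le r$, the various amalgamations up to isomorphism, $\nu(\alpha)=\sum_{i=1}^r\nu(\alpha'_i)$. $J_{p,q}$ is the poset on $\{a_1,\dots,a_p,\ast,b_1,\dots,b_q\}$ with order generated by $a_i<\ast$ and $\ast<b_j$. A measure valued in a field is determined by its matrix $N$. $\mathfrak{P}^+$ is the category of finite posets and monotone maps ($x\le y\Rightarrow\alpha(x)\le\alpha(y)$); it has all push-outs, and push-outs of embeddings are embeddings. A degree function on $\mathfrak{P}^+$ valued in $k$ is a rule $\kappa$ assigning to each embedding $\alpha$ of finite posets a value $\kappa(\alpha)\in k$ such that (a) $\kappa(\alpha)=1$ if $\alpha$ is an isomorphism; (b) $\kappa(\beta\circ\alpha)=\kappa(\beta)\kappa(\alpha)$ when defined; (c) if $\alpha\colon P\to Q$ is an embedding, $\beta\colon P\to P'$ is an arbitrary monotone map, and $\alpha'\colon P'\to Q'$ is the push-out of $\alpha$ along $\beta$ in $\mathfrak{P}^+$, then $\kappa(\alpha')=\kappa(\alpha)$. A quotient of a poset $Q$ is a surjective monotone map $Q\to R$; $\mathrm{Quot}(Q)$ is the poset of quotients up to isomorphism under $Q$, with $R\le R'$ if $Q\to R$ factors through $Q\to R'$ via a monotone map (so $Q$ is the maximal element). A degree function $\kappa$ induces a measure $\nu$ for $\mathfrak{P}$ by $$\nu(\alpha\colon P\to Q)=\sum_{\beta}\mu(R,Q)\,\kappa(\beta\circ\alpha),$$ the sum over quotients $\beta\colon Q\to R$ in $\mathrm{Quot}(Q)$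 such that $\beta\circ\alpha\colon P\to R$ is an embedding of posets, with $\mu$ the Möbius function of $\mathrm{Quot}(Q)$. A measure is Knop-like if it arises from some degree function on $\mathfrak{P}^+$ (valued in $k$) in this way. *)

(* Defs.v *)
From HB Require Import structures.
From mathcomp Require Import all_boot all_order all_algebra.
From Stdlib Require Import Classical_Prop.
Set Implicit Arguments.
Unset Strict Implicit.
Unset Printing Implicit Defensive.
Import Order.TTheory GRing.Theory.
Local Open Scope order_scope.

(* The display is a mere tag, fixed once and for all: every finite poset has a
   copy carrying it. *)
Fact poset_display : Order.disp_t. Proof. exact: Order.Disp tt tt. Qed.
Notation poset := (finPOrderType poset_display).

Definition is_embedding (P Q : poset) (f : P -> Q) : bool :=
  injectiveb f && [forall x, forall y, (x <= y) == (f x <= f y)].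

(* Built on finite functions, so that pointwise equal embeddings are equal. *)
Record embedding (P Q : poset) := Embedding {
  emb_fun :> {ffun P -> Q};
  embP : is_embedding emb_fun
}.
HB.instance Definition _ (P Q : poset) := [isSub of embedding P Q for @emb_fun P Q].

Lemma is_embeddingP (P Q : poset) (f : P -> Q) :
  reflect (injective f /\ {mono f : x y / x <= y}) (is_embedding f).
Proof.
apply: (iffP andP) => -[injf monof]; split; try exact/injectiveP.
  by move=> x y; move/forallP/(_ x)/forallP/(_ y)/eqP: monof.
by apply/forallP => x; apply/forallP => y; rewrite monof.
Qed.

Lemma emb_comp_subproof (P Q R : poset) (b : embedding Q R)
  (a : embedding P Q) : is_embedding [ffun x => b (a x)].
Proof.
have /is_embeddingP[injb monob] := embP b.
have /is_embeddingP[inja monoa] := embP a.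
apply/is_embeddingP; split=> x y; rewrite !ffunE ?monob ?monoa //.
by move=> /injb /inja.
Qed.

Definition emb_comp (P Q R : poset) (b : embedding Q R) (a : embedding P Q) :
  embedding P R := Embedding (emb_comp_subproof b a).

Definition emb_iso (P Q : poset) (a : embedding P Q) : Prop :=
  exists b : embedding Q P, cancel a b /\ cancel b a.

Definition emb_rule (k : fieldType) : Type :=
  forall P Q : poset, embedding P Q -> k.

Definition representatives (I X : Type) (iso : X -> X -> Prop) (F : I -> X) :=
  (forall i j, iso (F i) (F j) -> i = j) /\ (forall x, exists i, iso x (F i)).

Record amalgamation (P Q P' : poset) (a : embedding P Q)
    (b : embedding P P') := Amalgamation {
  amalg_obj : poset;
  amalg_a : embedding P' amalg_obj;
  amalg_b : embedding Q amalg_obj;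
  amalg_comm : forall x, amalg_b (a x) = amalg_a (b x);
  amalg_cover : forall z,
    (exists y, amalg_a y = z) \/ (exists y, amalg_b y = z)
}.

Definition amalg_iso (P Q P' : poset) (a : embedding P Q) (b : embedding P P')
    (A B : amalgamation a b) : Prop :=
  exists h : embedding (amalg_obj A) (amalg_obj B),
    [/\ emb_iso h, forall y, h (amalg_a A y) = amalg_a B y
      & forall y, h (amalg_b A y) = amalg_b B y].

Record is_measure (k : fieldType) (nu : emb_rule k) : Prop := IsMeasure {
  measure_iso : forall (P Q : poset) (a : embedding P Q),
    emb_iso a -> nu P Q a = 1%R;
  measure_comp : forall (P Q R : poset) (a : embedding P Q)
    (b : embedding Q R), nu P R (emb_comp b a) = (nu Q R b * nu P Q a)%R;
  measure_amalg : forall (P Q P' : poset) (a : embedding P Q)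
      (b : embedding P P') (r : nat) (A : 'I_r -> amalgamation a b),
    representatives (@amalg_iso P Q P' a b) A ->
    nu P Q a = (\sum_(i < r) nu P' (amalg_obj (A i)) (amalg_a (A i)))%R
}.

Definition monotone (P Q : poset) (f : P -> Q) : Prop :=
  {homo f : x y / x <= y}.

(* [a'] is the push-out of [a] along [b], with [b'] the remaining side of the
   square, in the category of finite posets and monotone maps. *)
Definition is_pushout (P Q P' Q' : poset) (a : P -> Q) (b : P -> P')
    (a' : P' -> Q') (b' : Q -> Q') : Prop :=
  [/\ monotone a', monotone b', forall x, b' (a x) = a' (b x)
    & forall (X : poset) (f : P' -> X) (g : Q -> X),
        monotone f -> monotone g -> (forall x, g (a x) = f (b x)) ->
        exists h : Q' -> X,
          [/\ monotone h, forall y, h (a' y) = f y, forall y, h (b' y) = g y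
            & forall h' : Q' -> X, monotone h' ->
                (forall y, h' (a' y) = f y) -> (forall y, h' (b' y) = g y) ->
                h' =1 h]].

(* In [degree_pushout], requiring [a'] to be an embedding is no restriction:
   push-outs of embeddings are embeddings. *)
Record is_degree (k : fieldType) (kappa : emb_rule k) : Prop := IsDegree {
  degree_iso : forall (P Q : poset) (a : embedding P Q),
    emb_iso a -> kappa P Q a = 1%R;
  degree_comp : forall (P Q R : poset) (a : embedding P Q)
      (b : embedding Q R),
    kappa P R (emb_comp b a) = (kappa Q R b * kappa P Q a)%R;
  degree_pushout : forall (P Q P' Q' : poset) (a : embedding P Q)
      (b : P -> P') (a' : embedding P' Q') (b' : Q -> Q'),
    monotone b -> is_pushout a b a' b' -> kappa P' Q' a' = kappa P Q a
}.

Record quotient (Q : poset) := Quotient {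
  quot_obj :> poset;
  quot_map : Q -> quot_obj;
  quot_monotone : monotone quot_map;
  quot_surj : forall y, exists x, quot_map x = y
}.

Definition quot_iso (Q : poset) (R R' : quotient Q) : Prop :=
  exists h : embedding R R',
    emb_iso h /\ forall x, h (quot_map R x) = quot_map R' x.

Definition quot_le (Q : poset) (R R' : quotient Q) : Prop :=
  exists h : R' -> R,
    monotone h /\ forall x, h (quot_map R' x) = quot_map R x.

Lemma quot_id_surj (Q : poset) (y : Q) : exists x, id x = y.
Proof. by exists y. Qed.

Definition quot_id (Q : poset) : quotient Q :=
  @Quotient Q Q id (fun _ _ => id) (@quot_id_surj Q).

(* The poset [T], whose elements index the quotients [R i], is a copy of the
   poset of isomorphism classes of quotients of [Q]. *)
Definition is_Quot (Q T : poset) (R : T -> quotient Q) : Prop :=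
  representatives (@quot_iso Q) R /\
  forall i j : T, i <= j <-> quot_le (R i) (R j).

(* The first argument is fuel; [#|T|] bounds the length of chains in [T]. *)
Fixpoint mobius_rec (T : poset) (n : nat) (x y : T) : int :=
  if n is m.+1 then
    if x == y then 1%R
    else if x < y then
      (- \sum_(z : T | ((x <= z) && (z < y))%O) mobius_rec m x z)%R
    else 0%R
  else 0%R.

Definition mobius (T : poset) (x y : T) : int := mobius_rec #|T| x y.

Lemma mobius_recE (T : poset) (n m : nat) (x y : T) :
  (#|[pred z | (x <= z <= y)%O]| <= n)%N ->
  (#|[pred z | (x <= z <= y)%O]| <= m)%N ->
  mobius_rec n x y = mobius_rec m x y.
Proof.
have rec0 l y' : (#|[pred z | (x <= z <= y')%O]| <= 0)%N ->
    mobius_rec l x y' = 0%R.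
  rewrite leqn0 => /eqP/card0_eq/(_ y'); rewrite inE lexx andbT => nxy.
  case: l => //= l; case: (eqVneq x y') nxy => [->|_] nxy.
    by rewrite lexx in nxy.
  by case: ifP => // /ltW; rewrite nxy.
elim: n m y => [|n IHn] m y cn cm; first by rewrite [RHS]rec0.
case: m cm => [|m] cm /=; first by rewrite -[LHS]/(mobius_rec n.+1 x y) rec0.
case: (eqVneq x y) => // xy.
case: ifP => // lt_xy; congr (- _)%R; apply: eq_bigr => z.
case/andP=> le_xz lt_zy.
have c : (#|[pred t | (x <= t <= z)%O]| < #|[pred t | (x <= t <= y)%O]|)%N.
  apply/proper_card/properP; split.
    apply/subsetP => t; rewrite !inE => /andP[-> /=] tz.
    exact: le_trans tz (ltW lt_zy).
  by exists y; rewrite inE /= ?lexx ?(ltW lt_xy) ?(lt_geF lt_zy) ?andbF.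
by apply: IHn; rewrite -ltnS; apply: leq_trans c _.
Qed.

Lemma mobiusxx (T : poset) (x : T) : mobius x x = 1%R.
Proof.
by rewrite /mobius (cardD1 x) inE add1n /= eqxx.
Qed.

Lemma mobius_sum (T : poset) (x y : T) : x < y ->
  (\sum_(z : T | (x <= z <= y)%O) mobius x z = 0)%R.
Proof.
move=> lt_xy; rewrite (bigD1 y) ?lexx ?(ltW lt_xy) //=.
rewrite (eq_bigl (fun z => (x <= z < y)%O)); last first.
  by move=> z; rewrite lt_neqAle -andbA [(z <= y) && _]andbC.
rewrite {1}/mobius (cardD1 x) inE add1n /= (lt_eqF lt_xy) lt_xy.
apply/eqP; rewrite addrC subr_eq0; apply/eqP/eq_bigr => z /andP[le_xz lt_zy].
apply: mobius_recE; first exact: max_card.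
have -> : #|[predD1 T & x]| = #|T|.-1 by rewrite [#|T|](cardD1 x) inE.
have : (#|[pred t | (x <= t <= z)%O]| < #|T|)%N; last by case: #|T|.
apply: leq_trans (max_card [pred t | (x <= t <= y)%O]).
apply/proper_card/properP; split.
  apply/subsetP => t; rewrite !inE => /andP[-> /=] tz.
  exact: le_trans tz (ltW lt_zy).
by exists y; rewrite inE /= ?lexx ?(ltW lt_xy) ?(lt_geF lt_zy) ?andbF.
Qed.

Lemma mobius_out (T : poset) (x y : T) : ~~ (x <= y) -> mobius x y = 0%R.
Proof.
rewrite /mobius; case: #|T| => //= n; case: (eqVneq x y) => [->|_ nle].
  by rewrite lexx.
by case: ifP => // /ltW; rewrite (negPf nle).
Qed.

Definition extend0 (k : fieldType) (kappa : emb_rule k) (P R : poset)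
    (f : P -> R) : k :=
  oapp (@kappa P R) 0%R (insub [ffun x => f x]).

Lemma extend0_emb (k : fieldType) (kappa : emb_rule k) (P R : poset)
  (a : embedding P R) : extend0 kappa a = kappa P R a.
Proof.
rewrite /extend0 (_ : [ffun x => a x] = val a) ?valK //.
by apply/ffunP => x; rewrite ffunE.
Qed.

Lemma extend0_out (k : fieldType) (kappa : emb_rule k) (P R : poset)
  (f : P -> R) : ~~ is_embedding f -> extend0 kappa f = 0%R.
Proof.
move=> nf; rewrite /extend0 insubN //; apply: contra nf.
case/is_embeddingP=> injf monof; apply/is_embeddingP; split=> x y.
  by move=> fxy; apply: injf; rewrite !ffunE.
by rewrite -monof !ffunE.
Qed.

(* [extend0] discards the quotients whose composite with [a] is not an
   embedding; [top] is the index of the maximal element [Q] of Quot(Q). *)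
Definition induces (k : fieldType) (kappa nu : emb_rule k) : Prop :=
  forall (P Q : poset) (a : embedding P Q)
    (T : poset) (R : T -> quotient Q) (top : T),
    is_Quot R -> quot_iso (quot_id Q) (R top) ->
    nu P Q a = (\sum_(i : T) (mobius i top)%:~R *
                  extend0 kappa (fun x => quot_map (R i) (a x)))%R.

Definition knop_like (k : fieldType) (nu : emb_rule k) : Prop :=
  exists kappa : emb_rule k, is_degree kappa /\ induces kappa nu.

(* Complete systems of amalgamations and copies of Quot(Q) always exist, so
   the conditions [measure_amalg] and [induces] are never vacuous. *)
Definition pullback_order (X : finType) (S : poset) (f : X -> S) :
  {set X * X} := [set u | f u.1 <= f u.2].

Lemma pullback_order_iso (X : finType) (S S' : poset) (f : X -> S)
    (f' : X -> S') :
  (forall y, exists x, f x = y) -> (forall y, exists x, f' x = y) ->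
  pullback_order f = pullback_order f' ->
  exists h : embedding S S', emb_iso h /\ forall x, h (f x) = f' x.
Proof.
move=> /fin_all_exists[s fs] /fin_all_exists[s' fs'] /setP ff'.
have le_ff' x y : (f x <= f y) = (f' x <= f' y).
  by have := ff' (x, y); rewrite !inE.
have sE x : f' (s (f x)) = f' x.
  by apply/le_anti; rewrite -!le_ff' fs lexx.
have s'E x : f (s' (f' x)) = f x.
  by apply/le_anti; rewrite !le_ff' fs' lexx.
have hE : is_embedding [ffun y => f' (s y)].
  apply/is_embeddingP; split=> x y; rewrite !ffunE -?le_ff' ?fs //.
  by move=> e; rewrite -[x]fs -[y]fs -s'E e s'E.
have gE : is_embedding [ffun y => f (s' y)].
  apply/is_embeddingP; split=> x y; rewrite !ffunE ?le_ff' ?fs' //.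
  by move=> e; rewrite -[x]fs' -[y]fs' -sE e sE.
exists (Embedding hE); split=> [|x]; last by rewrite ffunE.
by exists (Embedding gE); split=> x; rewrite /= !ffunE ?s'E ?sE ?fs ?fs'.
Qed.

Lemma representatives_exist (X : Type) (iso : X -> X -> Prop) (U : finType)
    (key : X -> U) : (forall x y, iso x y <-> key x = key y) ->
  exists (A : {set U}) (F : {u | u \in A} -> X),
    representatives iso F /\ forall u, key (F u) = val u.
Proof.
move=> isoE.
have /fin_all_exists[b bP] (u : U) :
    exists b : bool, b <-> exists x, key x = u.
  by have [e|e] := classic (exists x, key x = u);
    [exists true | exists false].
have /fin_all_exists[F FK] (u : {u | u \in [set u | b u]}) :
    exists x, key x = val u.
  by apply/bP; have := valP u; rewrite inE.
exists [set u | b u], F; split=> //; split=> [i j|x].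
  by move/isoE; rewrite !FK => /val_inj.
have bx : key x \in [set u | b u] by rewrite inE; apply/bP; exists x.
by exists (Sub (key x) bx); apply/isoE; rewrite FK SubK.
Qed.

Definition amalg_map (P Q P' : poset) (a : embedding P Q) (b : embedding P P')
    (A : amalgamation a b) (x : Q + P') : amalg_obj A :=
  match x with inl y => amalg_b A y | inr y => amalg_a A y end.

Lemma amalgamations_exist (P Q P' : poset) (a : embedding P Q)
    (b : embedding P P') :
  exists (r : nat) (A : 'I_r -> amalgamation a b),
    representatives (@amalg_iso P Q P' a b) A.
Proof.
have [|S [F [[Finj Fsurj] _]]] := @representatives_exist _
    (@amalg_iso P Q P' a b) _ (fun A => pullback_order (@amalg_map _ _ _ _ _ A)).
  have surj A z : exists x, @amalg_map _ _ _ a b A x = z.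
    by have [[y <-]|[y <-]] := amalg_cover z; [exists (inr y)|exists (inl y)].
  move=> A B; split.
    case=> h [_ hA hB]; have /is_embeddingP[_ hM] := embP h.
    have hE x : h (amalg_map A x) = amalg_map B x by case: x => y /=.
    by apply/setP => -[x y]; rewrite !inE /= -!hE hM.
  case/(pullback_order_iso (surj A) (surj B)) => h [hI hE].
  by exists h; split=> // y; [apply: (hE (inr y))|apply: (hE (inl y))].
exists #|{: {u | u \in S}}|, (fun i => F (enum_val i)).
split=> [i j /Finj /enum_val_inj //|B].
by have [u uP] := Fsurj B; exists (enum_rank u); rewrite enum_rankK.
Qed.

Definition preorder_poset (X : finType) (A : {set {set X}}) : Type :=
  {u | u \in A}.
HB.instance Definition _ X A := Finite.on (@preorder_poset X A).

Lemma preorder_poset_refl (X : finType) (A : {set {set X}}) :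
  reflexive (fun u v : preorder_poset A => sval v \subset sval u).
Proof. by move=> u /=. Qed.

Lemma preorder_poset_anti (X : finType) (A : {set {set X}}) :
  antisymmetric (fun u v : preorder_poset A => sval v \subset sval u).
Proof.
by move=> u v; rewrite andbC => uv; apply/val_inj/eqP; rewrite eqEsubset.
Qed.

Lemma preorder_poset_trans (X : finType) (A : {set {set X}}) :
  transitive (fun u v : preorder_poset A => sval v \subset sval u).
Proof. by move=> v u w /= uv vw; apply: subset_trans vw uv. Qed.

HB.instance Definition _ (X : finType) (A : {set {set X}}) :=
  Order.Le_isPOrder.Build poset_display (preorder_poset A)
    (@preorder_poset_refl X A) (@preorder_poset_anti X A)
    (@preorder_poset_trans X A).

Lemma quot_le_pullback (Q : poset) (R R' : quotient Q) :
  quot_le R R' <->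
  pullback_order (quot_map R') \subset pullback_order (quot_map R).
Proof.
split=> [[h [hM hE]]|/subsetP sub].
  by apply/subsetP => -[x y]; rewrite !inE /= -!hE => /hM.
have le_q x y : quot_map R' x <= quot_map R' y -> quot_map R x <= quot_map R y.
  by have := sub (x, y); rewrite !inE.
have /fin_all_exists[s sK] := @quot_surj _ R'.
exists (fun y => quot_map R (s y)); split=> [y z yz|x].
  by apply: le_q; rewrite !sK.
by apply/le_anti/andP; split; apply: le_q; rewrite sK.
Qed.

Lemma Quot_exists (Q : poset) :
  exists (T : poset) (R : T -> quotient Q), is_Quot R.
Proof.
have [|S [F [FP FK]]] := @representatives_exist _ (@quot_iso Q) _
    (fun R => pullback_order (quot_map R)).
  move=> R R'; split=> [[h [_ hE]]|].
    have /is_embeddingP[_ hM] := embP h.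
    by apply/setP => -[x y]; rewrite !inE /= -!hE hM.
  by move/(pullback_order_iso (@quot_surj _ R) (@quot_surj _ R')).
exists (preorder_poset S : poset), F; split=> // i j.
by rewrite quot_le_pullback !FK.
Qed.

(* [Some (inl i)] is a_i, [None] is the point *, [Some (inr j)] is b_j. *)
Definition J (p q : nat) : Type := option ('I_p + 'I_q).
HB.instance Definition _ p q := Finite.on (J p q).

Definition J_gen (p q : nat) : rel (J p q) := fun x y =>
  match x, y with
  | Some (inl _), None => true
  | None, Some (inr _) => true
  | _, _ => false
  end.

Definition J_rank (p q : nat) (x : J p q) : nat :=
  match x with Some (inl _) => 0 | None => 1 | Some (inr _) => 2 end.

Lemma J_connectE p q (x y : J p q) :
  connect (@J_gen p q) x y = (x == y) || (J_rank x < J_rank y)%N.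
Proof.
apply/idP/idP => [/connectP[s]|/orP[/eqP->|]]; last 2 first.
- exact: connect0.
- move: x y => [[i|j]|] [[i'|j']|] //= _; try exact: connect1.
  by apply: (@connect_trans _ _ None); apply: connect1.
elim: s x => [|z s IHs] x /=; first by move=> _ ->; rewrite eqxx.
move=> /andP[xz zs] yE; have {IHs zs yE} := IHs z zs yE.
have {xz} : (J_rank x < J_rank z)%N by case: x z xz => [[i|j]|] [[i'|j']|].
by move=> xz /orP[/eqP<-|/(ltn_trans xz)->]; rewrite ?xz orbT.
Qed.

Lemma J_le_anti p q : antisymmetric (connect (@J_gen p q)).
Proof.
move=> x y; rewrite !J_connectE [y == x]eq_sym => /andP[/orP[/eqP//|xy]].
by case/orP => [/eqP//|yx]; have := ltn_trans xy yx; rewrite ltnn.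
Qed.

HB.instance Definition _ p q := Order.Le_isPOrder.Build poset_display (J p q)
  (@connect0 _ (@J_gen p q)) (@J_le_anti p q) (@connect_trans _ (@J_gen p q)).

Definition remove (P : poset) (x : P) : Type := {y : P | y != x}.
HB.instance Definition _ (P : poset) (x : P) := SubFinite.on (remove x).
HB.instance Definition _ (P : poset) (x : P) :=
  [SubChoice_isSubPOrder of remove x by <: with poset_display].

Lemma remove_incl_subproof (P : poset) (x : P) :
  is_embedding [ffun y : remove x => val y].
Proof.
by apply/is_embeddingP; split=> y z; rewrite !ffunE //; apply: val_inj.
Qed.

Definition remove_incl (P : poset) (x : P) : embedding (remove x) P :=
  Embedding (remove_incl_subproof x).

Local Open Scope ring_scope.

Definition star (p q : nat) : J p q := None.

Definition measure_matrix (k : fieldType) (nu : emb_rule k) : 'M[k]_3 :=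
  \matrix_(p < 3, q < 3)
    nu (remove (star p q)) (J p q) (remove_incl (star p q)).

Definition mx_of_rows (k : fieldType) (s : seq (seq k)) : 'M[k]_3 :=
  \matrix_(i < 3, j < 3) nth 0 (nth [::] s i) j.

Definition B5 (k : fieldType) (t : k) : 'M[k]_3 :=
  mx_of_rows [:: [::  t; -1; 0];
                 [:: -1; -1; 0];
                 [::  0;  0; 1]].

Definition C7 (k : fieldType) : 'M[k]_3 :=
  mx_of_rows [:: [:: 0; -1; 0];
                 [:: 0; -1; 0];
                 [:: 1;  0; 1]].

Definition C8 (k : fieldType) : 'M[k]_3 :=
  mx_of_rows [:: [:: 1;  0; 1];
                 [:: 0; -1; 0];
                 [:: 1;  0; 1]].

(* Main.v *)
Require Import Defs.
From HB Require Import structures.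
From mathcomp Require Import all_boot all_order all_algebra.
From Stdlib Require Import ClassicalEpsilon.
Set Implicit Arguments.
Unset Strict Implicit.
Unset Printing Implicit Defensive.
Import Order.TTheory GRing.Theory.
Local Open Scope ring_scope.

(** Measures and degree functions are multiplicative, hence governed by
    one-point extensions, and the theorem is a comparison of the two theories
    at the posets [J p q].

    Let [N p q] be the value of a measure at the removal of the centre of
    [J p q]. Given bounds [A <= B] in a poset, sum the measure over all the
    ways of adjoining a point [x] with [A <= x <= B], where [x] may fall on an
    old point, which contributes 1. By the amalgamation axiom the sum depends
    only on the poset [A :|: B] ([extsum_restr]); for antichains of sizes [p]
    and [q] it is [f p q = N p q + (p == 1) + (q == 1)] ([extsum_antichain]).
    Such a sum runs over the quotients in which the old points are still
    embedded, so by Moebius inversion it is a value of the degree function, if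
    there is one: a measure is Knop-like if and only if [f p q] is the value
    at [J p q] of some degree function ([knop_likeP]).

    A degree function is invariant under push-outs. Collapsing the antichains
    of [J p q] shows that its value there depends only on whether [p] and [q]
    vanish ([starval_bits]), and collapsing a chain onto a point that it is 1
    if neither does ([starbit11]). Call [s], [u], [v] its values at [J 0 0],
    [J 1 0], [J 0 1]. Adjoining two points in both orders gives
    [u u = u], [v v = v] and [s u = u v = s v] ([starbit_relations]); the
    solutions are [u = v = 0] with [s] arbitrary, and the triples
    [(0, 1, 0)], [(0, 0, 1)], [(1, 1, 1)]. They correspond to the four
    families of matrices.

    Conversely, let a measure have one of these matrices. Adjoin a point [x]
    above an antichain of size [p.+2] and below one of size [q], and below
    [x] a point [a] above two elements of the first antichain and below
    [m] further points. If [f 2 k = 1] for [0 < k <= m.+1], comparing the two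
    orders of insertion gives [f p.+2 q = f 2 (q + m) * f p.+1 q]
    ([fval_insert]), and this suffices to show that [f p q] depends only on
    whether [p] and [q] vanish ([fval_bits]). Each triple is realized by a
    degree function: the constant 1; the indicator that each element of the
    target lies above, or below, an element of the source; and [t] to the number of isolated new elements if each other element lies
    between elements of the source, and 0 otherwise. Finally the sum of the
    measure over all quotients is multiplicative and has the right values on
    one-point extensions, so it equals that degree function
    ([sum_coarser]), and Moebius inversion concludes ([knop_inversion]).

    Posets are handled as preorders on subsets of a fixed finite type. The sum
    over amalgamations, the sum over quotients and the restriction to a
    subposet then become operations on sets of pairs, and a point falling on
    another one is an ordinary preorder. *)

(** * Preorders and the posets they present *)

Section Preorders.
Variable X : finType.
Implicit Types (r s : {set X * X}) (A B C D : {set X}) (x y z : X).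

(** A relation carries its own domain, namely the points related to
    themselves. *)
Definition supp r := [set x | (x, x) \in r].

Definition preo r : bool :=
  [forall x, forall y, ((x, y) \in r) ==> (x \in supp r) && (y \in supp r)]
  && [forall x, forall y, forall z,
        ((x, y) \in r) ==> ((y, z) \in r) ==> ((x, z) \in r)].

Definition restr r D : {set X * X} := r :&: setX D D.

Definition eqv r x y := ((x, y) \in r) && ((y, x) \in r).

Lemma preoP r :
  reflect ((forall x y, (x, y) \in r -> x \in supp r /\ y \in supp r)
           /\ forall y x z, (x, y) \in r -> (y, z) \in r -> (x, z) \in r)
    (preo r).
Proof.
apply: (iffP andP) => -[Hs Ht]; split.
- move=> x y xy; apply/andP.
  by move/forallP/(_ x)/forallP/(_ y)/implyP: Hs; apply.
- move=> y x z xy yz; move/forallP/(_ x)/forallP/(_ y)/forallP/(_ z): Ht.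
  by move/implyP/(_ xy)/implyP/(_ yz).
- apply/forallP=> x; apply/forallP=> y; apply/implyP=> /Hs[-> ->] //.
- apply/forallP=> x; apply/forallP=> y; apply/forallP=> z.
  by apply/implyP=> xy; apply/implyP=> yz; apply: Ht xy yz.
Qed.

Lemma preo_supp r x y : preo r -> (x, y) \in r -> x \in supp r /\ y \in supp r.
Proof. by case/preoP=> + _; apply. Qed.

Lemma preo_trans r y x z :
  preo r -> (x, y) \in r -> (y, z) \in r -> (x, z) \in r.
Proof. by case/preoP=> _; apply. Qed.

Lemma restrE r D x y :
  ((x, y) \in restr r D) = [&& (x, y) \in r, x \in D & y \in D].
Proof. by rewrite !inE. Qed.

Lemma supp_restr r D : supp (restr r D) = supp r :&: D.
Proof. by apply/setP=> x; rewrite !inE andbb. Qed.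

Lemma restr_preo r D : preo r -> preo (restr r D).
Proof.
move=> pr; apply/preoP; split=> [x y|y x z]; rewrite !restrE.
  case/and3P=> xy xD yD; have [xs ys] := preo_supp pr xy.
  by rewrite supp_restr !inE xD yD in xs ys *; rewrite xs ys.
case/and3P=> xy -> _ /and3P[yz _ ->].
by rewrite (preo_trans pr xy yz).
Qed.

Lemma restr_restr r C D : restr (restr r D) C = restr r (C :&: D).
Proof.
by apply/setP=> -[x y]; rewrite !restrE !inE; do !case: (_ \in _).
Qed.

Lemma restr_id r D : preo r -> supp r \subset D -> restr r D = r.
Proof.
move=> pr /subsetP sD; apply/setP=> -[x y]; rewrite restrE andbA.
apply/andP/idP => [[/andP[]]//|xy]; have [/sD -> /sD ->] := preo_supp pr xy.
by rewrite xy.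
Qed.

Lemma eqv_sym r x y : eqv r x y = eqv r y x.
Proof. by rewrite /eqv andbC. Qed.

Lemma eqv_trans r y x z : preo r -> eqv r x y -> eqv r y z -> eqv r x z.
Proof.
move=> pr /andP[xy yx] /andP[yz zy].
by rewrite /eqv (preo_trans pr xy yz) (preo_trans pr zy yx).
Qed.

Lemma eqv_rel r x x' y y' : preo r -> eqv r x x' -> eqv r y y' ->
  ((x, y) \in r) = ((x', y') \in r).
Proof.
move=> pr /andP[xx' x'x] /andP[yy' y'y]; apply/idP/idP => xy.
  exact: preo_trans x'x (preo_trans pr xy yy').
exact: preo_trans xx' (preo_trans pr xy y'y).
Qed.

(** [s] is a section of the quotient map from the support of [r] onto the
    poset [Q]. The section is preferred to the quotient map because it is a
    total function even when the support is not the whole type. *)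
Definition rep r (Q : poset) (s : Q -> X) : Prop :=
  (forall q q', ((s q, s q') \in r) = (q <= q')%O)
  /\ forall e, e \in supp r -> exists q, eqv r e (s q).

(** The embedding [a] presents the inclusion of the subset [D] into the poset
    quotient of the preorder [r]. *)
Definition model r D (P Q : poset) (a : embedding P Q) : Prop :=
  exists (s : Q -> X) (t : P -> X),
    [/\ rep r s, rep (restr r D) t & forall p, eqv r (t p) (s (a p))].

(** The classes of [r] are encoded by their principal up-sets, ordered by
    reverse inclusion. *)
Lemma rep_exists r : preo r -> exists (Q : poset) (s : Q -> X), rep r s.
Proof.
move=> pr.
pose up d := [set y | (d, y) \in r].
pose Q : poset := preorder_poset [set up d | d in supp r].
have /fin_all_exists2[s ss sE] (u : Q) :
    exists2 d, d \in supp r & sval u = up d by exact/imsetP/(valP u).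
have upE d e : d \in supp r -> e \in supp r ->
    (up e \subset up d) = ((d, e) \in r).
  move=> ds es; apply/subsetP/idP => [/(_ e)|de y].
    by rewrite !inE; apply; rewrite inE in es.
  by rewrite !inE; apply: preo_trans.
exists Q, s; split=> [u v|e es].
  have -> : (u <= v)%O = (sval v \subset sval u) by [].
  by rewrite !sE upE.
have uQ : up e \in [set up d | d in supp r] by exact: imset_f.
exists (Sub (up e) uQ); set q := Sub _ _.
have := sE q; rewrite /= => E.
by rewrite /eqv -!upE // E !subxx.
Qed.

Lemma rep_supp r (Q : poset) (s : Q -> X) q : rep r s -> s q \in supp r.
Proof. by case=> sE _; rewrite inE sE. Qed.

Lemma rep_inj r (Q : poset) (s : Q -> X) q q' :
  rep r s -> eqv r (s q) (s q') -> q = q'.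
Proof. by case=> sE _ /andP[]; rewrite !sE => *; apply/le_anti/andP. Qed.

Lemma rep_map r D (P Q : poset) (t : P -> X) (s : Q -> X) :
  preo r -> rep (restr r D) t -> rep r s ->
  exists a : embedding P Q, forall p, eqv r (t p) (s (a p)).
Proof.
move=> pr tr sr.
have /fin_all_exists[a aE] (p : P) : exists q, eqv r (t p) (s q).
  case: sr => _; apply.
  by have := rep_supp p tr; rewrite supp_restr inE => /andP[].
have aM p p' : (p <= p')%O = (a p <= a p')%O.
  rewrite -sr.1 -tr.1 restrE (eqv_rel pr (aE p) (aE p')).
  have := rep_supp p tr; have := rep_supp p' tr.
  by rewrite !supp_restr !inE => /andP[_ ->] /andP[_ ->]; rewrite !andbT.
have aP : is_embedding [ffun p => a p].
  apply/is_embeddingP; split=> p p'; rewrite !ffunE => // e.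
  by apply/le_anti; rewrite !aM e lexx.
by exists (Embedding aP) => p; rewrite ffunE.
Qed.

Lemma model_exists r D : preo r ->
  exists (P Q : poset) (a : embedding P Q), model r D a.
Proof.
move=> pr; have [Q [s sr]] := rep_exists pr.
have [P [t tr]] := rep_exists (restr_preo D pr).
by have [a aE] := rep_map pr tr sr; exists P, Q, a, s, t.
Qed.

End Preorders.

Lemma emb_le (P Q : poset) (a : embedding P Q) x y :
  (a x <= a y)%O = (x <= y)%O.
Proof. by have /is_embeddingP[_ ->] := embP a. Qed.

Lemma emb_inj (P Q : poset) (a : embedding P Q) : injective a.
Proof. by have /is_embeddingP[] := embP a. Qed.

Lemma emb_eq (P Q : poset) (a b : embedding P Q) : a =1 b -> a = b.
Proof. by move=> ab; apply/val_inj/ffunP. Qed.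

Lemma emb_iso_surj (P Q : poset) (a : embedding P Q) :
  (forall q, exists p, a p = q) -> emb_iso a.
Proof.
move=> /fin_all_exists[b bK].
have bP : is_embedding [ffun q => b q].
  apply/is_embeddingP; split=> x y; rewrite !ffunE.
    by move=> e; rewrite -(bK x) e bK.
  by rewrite -(emb_le a) !bK.
exists (Embedding bP); split=> x; rewrite /= ffunE //.
by apply: (@emb_inj _ _ a); rewrite bK.
Qed.

Record is_compositional (k : fieldType) (nu : emb_rule k) : Prop := IsCompositional {
  mult_iso : forall (P Q : poset) (a : embedding P Q),
    emb_iso a -> nu P Q a = 1;
  mult_comp : forall (P Q R : poset) (a : embedding P Q) (b : embedding Q R),
    nu P R (emb_comp b a) = nu Q R b * nu P Q a }.

Lemma measure_mult (k : fieldType) (nu : emb_rule k) :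
  is_measure nu -> is_compositional nu.
Proof. by case. Qed.

Lemma degree_mult (k : fieldType) (nu : emb_rule k) :
  is_degree nu -> is_compositional nu.
Proof. by case. Qed.

(** The value of a rule at the inclusion of [D] in the quotient of [r]; by
    [model_unique] the presentation chosen does not matter. *)
Definition val_rule (k : fieldType) (nu : emb_rule k) (X : finType)
    (r : {set X * X}) (D : {set X}) : k :=
  epsilon (inhabits 0)
    (fun v => forall (P Q : poset) (a : embedding P Q),
       model r D a -> nu P Q a = v).

Section ValRule.
Variables (k : fieldType) (nu : emb_rule k).
Hypothesis nuM : is_compositional nu.

Lemma rep_iso (X : finType) (r : {set X * X}) (Q Q' : poset)
    (s : Q -> X) (s' : Q' -> X) : preo r -> rep r s -> rep r s' ->
  exists h : embedding Q Q', emb_iso h /\ forall q, eqv r (s q) (s' (h q)).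
Proof.
move=> pr sr s'r.
have [|h hE] := @rep_map _ r setT _ _ s s' pr _ s'r.
  by rewrite restr_id ?subsetT.
exists h; split=> //; apply: emb_iso_surj => q'.
have [q qE] := sr.2 _ (rep_supp q' s'r); exists q.
by apply/(rep_inj s'r); rewrite eqv_sym; apply: (eqv_trans pr qE).
Qed.

(** Two presentations differ by isomorphisms at both ends, which a
    compositional rule does not see. *)
Lemma model_unique (X : finType) (r : {set X * X}) (D : {set X})
    (P Q P' Q' : poset) (a : embedding P Q) (a' : embedding P' Q') :
  preo r -> model r D a -> model r D a' -> nu a = nu a'.
Proof.
move=> pr [s [t [sr tr aE]]] [s' [t' [s'r t'r a'E]]].
have [h [hI hE]] := rep_iso pr sr s'r.
have [g [gI gE]] := rep_iso (restr_preo D pr) tr t'r.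
rewrite -[LHS]mul1r -(mult_iso nuM hI) -(mult_comp nuM).
rewrite -[RHS]mulr1 -(mult_iso nuM gI) -(mult_comp nuM).
congr (nu _); apply: emb_eq => p; rewrite !ffunE /=.
apply/(rep_inj s'r)/(eqv_trans pr _ (a'E _)).
apply: (@eqv_trans _ _ (t p)) => //.
  by rewrite eqv_sym; apply: eqv_trans (aE p) (hE _).
by have := gE p; rewrite /eqv !restrE => /andP[/andP[-> _] /andP[-> _]].
Qed.

Lemma val_model (X : finType) (r : {set X * X}) (D : {set X})
    (P Q : poset) (a : embedding P Q) :
  preo r -> model r D a -> val_rule nu r D = nu a.
Proof.
move=> pr ma; apply/esym.
apply: (epsilon_spec (inhabits (0 : k)) (fun v => forall (P Q : poset)
  (a : embedding P Q), model r D a -> nu a = v)) ma.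
have [P' [Q' [a' ma']]] := model_exists D pr.
by exists (nu a') => P2 Q2 a2 ma2; apply: model_unique ma2 ma'.
Qed.

Lemma val_equiv (X : finType) (r : {set X * X}) (D : {set X}) :
  preo r -> (forall e, e \in supp r -> exists2 d, d \in D & eqv r e d) ->
  val_rule nu r D = 1.
Proof.
move=> pr De; have [P [Q [a ma]]] := model_exists D pr.
rewrite (val_model pr ma) (mult_iso nuM) //.
case: ma => s [t [sr tr aE]]; apply: emb_iso_surj => q.
have [d dD qd] := De _ (rep_supp q sr).
have ds : d \in supp (restr r D).
  by case/andP: qd => _ /(preo_supp pr)[+ _]; rewrite supp_restr !inE dD andbT.
have [p pE] := tr.2 _ ds; exists p; apply: (rep_inj sr).
rewrite eqv_sym; apply: (eqv_trans pr qd).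
apply: eqv_trans (aE p) => //.
by move: pE; rewrite /eqv !restrE => /andP[/andP[-> _] /andP[-> _]].
Qed.

Lemma val_mul (X : finType) (r : {set X * X}) (C D : {set X}) :
  preo r -> C \subset D ->
  val_rule nu r C = val_rule nu (restr r D) C * val_rule nu r D.
Proof.
move=> pr CD; have [Q [s sr]] := rep_exists pr.
have pD := restr_preo D pr; have pC := restr_preo C pD.
have [P [t tr]] := rep_exists pD; have [O [w wr]] := rep_exists pC.
have [a aE] := rep_map pr tr sr; have [b bE] := rep_map pD wr tr.
have rC : restr (restr r D) C = restr r C.
  by rewrite restr_restr (setIidPl CD).
rewrite (@val_model _ r D _ _ a) //; last by exists s, t.
rewrite (@val_model _ (restr r D) C _ _ b) //; last by exists t, w.
rewrite (@val_model _ r C _ _ (emb_comp a b)) //.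
  by rewrite (mult_comp nuM) mulrC.
exists s, w; split=> //; first by rewrite -rC.
move=> p; rewrite ffunE; apply: eqv_trans (aE _) => //.
by move: (bE p); rewrite /eqv !restrE => /andP[/andP[-> _] /andP[-> _]].
Qed.

End ValRule.

(** * Amalgamation as a sum over preorders *)

Definition amalgams (X : finType) (r1 r2 : {set X * X}) : {set {set X * X}} :=
  [set r | [&& preo r, supp r == supp r1 :|: supp r2,
      restr r (supp r1) == r1 & restr r (supp r2) == r2]].

Lemma eqv_restr (X : finType) (r : {set X * X}) (D : {set X}) x y :
  eqv (restr r D) x y -> eqv r x y.
Proof. by rewrite /eqv !restrE => /andP[/andP[-> _] /andP[-> _]]. Qed.

Lemma eqv_supp (X : finType) (r : {set X * X}) x y : preo r ->
  eqv r x y -> x \in supp r /\ y \in supp r.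
Proof. by move=> pr /andP[/(preo_supp pr)]. Qed.

(** Amalgamations of two posets over their common part correspond to the
    preorders on the union of the two supports that restrict to both; the
    identification of points in an amalgamation is what makes preorders,
    rather than orders, the right objects. *)
Section Amalgamation.
Variables (k : fieldType) (nu : emb_rule k).
Hypothesis nuP : is_measure nu.
Variables (X : finType) (r1 r2 : {set X * X}).
Hypotheses (pr1 : preo r1) (pr2 : preo r2).
Let C := supp r1 :&: supp r2.
Hypothesis r12 : restr r1 C = restr r2 C.

Section Link.
Variables (P Q P' : poset) (s : Q -> X) (t : P' -> X) (w : P -> X).
Variables (a : embedding P Q) (b : embedding P P').
Hypotheses (sr : rep r1 s) (tr : rep r2 t) (wr : rep (restr r1 C) w).
Hypotheses (aE : forall p, eqv r1 (w p) (s (a p)))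
  (bE : forall p, eqv r2 (w p) (t (b p))).

(** The points of [X] are compared with the disjoint union of the two posets,
    which maps onto each amalgamation. *)
Let link x (u : Q + P') :=
  match u with inl y => eqv r1 x (s y) | inr z => eqv r2 x (t z) end.

Let linked (A : amalgamation a b) (r : {set X * X}) :=
  forall x y u v, link x u -> link y v ->
    ((x, y) \in r) = (amalg_map A u <= amalg_map A v)%O.

Let link_ex x : x \in supp r1 :|: supp r2 -> exists u, link x u.
Proof.
case/setUP=> [/(sr.2)|/(tr.2)] [q xq]; by [exists (inl q)|exists (inr q)].
Qed.

Let link_supp x u : link x u -> x \in supp r1 :|: supp r2.
Proof.
rewrite in_setU; case: u => u /= xu; first by rewrite (eqv_supp pr1 xu).1.
by rewrite (eqv_supp pr2 xu).1 orbT.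
Qed.

Let linked_inj A r r' : r \in amalgams r1 r2 -> r' \in amalgams r1 r2 ->
  linked A r -> linked A r' -> r = r'.
Proof.
rewrite !inE => /and4P[pr /eqP rs _ _] /and4P[pr' /eqP rs' _ _] lr lr'.
apply/setP=> -[x y]; have [xs|xs] := boolP (x \in supp r1 :|: supp r2); last first.
  by apply/idP/idP=> /preo_supp[]//; rewrite ?rs ?rs' (negPf xs).
have [ys|ys] := boolP (y \in supp r1 :|: supp r2); last first.
  by apply/idP/idP=> /preo_supp[]//; rewrite ?rs ?rs' (negPf ys).
have [u xu] := link_ex xs; have [v yv] := link_ex ys.
by rewrite (lr _ _ u v) // (lr' _ _ u v).
Qed.

Let linked_iso A B r : linked A r -> linked B r -> amalg_iso A B.
Proof.
move=> lA lB; pose sg u := match u with inl y => s y | inr z => t z end.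
have sgP u : link (sg u) u by case: u => u /=; rewrite /eqv ?sr.1 ?tr.1 lexx.
have surj D z : exists x, @amalg_map _ _ _ a b D x = z.
  by have [[y <-]|[y <-]] := amalg_cover z; [exists (inr y)|exists (inl y)].
have [|h [hI hE]] := pullback_order_iso (surj A) (surj B).
  by apply/setP=> -[u v]; rewrite !inE /= -(lA (sg u) (sg v)) // (lB _ _ u v).
by exists h; split=> // y; [apply: (hE (inr y))|apply: (hE (inl y))].
Qed.

Let iso_linked A B r : amalg_iso A B -> linked A r -> linked B r.
Proof.
case=> h [_ hA hB] lA x y u v xu yv; rewrite (lA _ _ u v) //.
have hE z : h (amalg_map A z) = amalg_map B z by case: z => z /=.
by rewrite -!hE emb_le.
Qed.

Let amalg_of r : r \in amalgams r1 r2 ->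
  exists A : amalgamation a b, linked A r /\ model r (supp r2) (amalg_a A).
Proof.
rewrite inE => /and4P[pr /eqP rs /eqP rr1 /eqP rr2].
have [Q' [q qr]] := rep_exists pr.
have [|a' a'E] := @rep_map _ r (supp r2) _ _ t q pr _ qr; first by rewrite rr2.
have [|b' b'E] := @rep_map _ r (supp r1) _ _ s q pr _ qr; first by rewrite rr1.
have sub1 x y : eqv r1 x y -> eqv r x y by rewrite -rr1; apply: eqv_restr.
have sub2 x y : eqv r2 x y -> eqv r x y by rewrite -rr2; apply: eqv_restr.
have comm x : b' (a x) = a' (b x).
  apply: (rep_inj qr); rewrite eqv_sym; apply: (eqv_trans pr _ (b'E _)).
  rewrite eqv_sym; apply: (eqv_trans pr _ (a'E _)).
  apply: (eqv_trans pr _ (sub2 _ _ (bE x))).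
  by rewrite eqv_sym; apply: sub1.
have cover z : (exists y, a' y = z) \/ (exists y, b' y = z).
  have := rep_supp z qr; rewrite rs => /link_ex[[y|y] /= zy]; [right|left];
    exists y; apply: (rep_inj qr); rewrite eqv_sym.
  - by apply: eqv_trans (sub1 _ _ zy) (b'E y).
  - by apply: eqv_trans (sub2 _ _ zy) (a'E y).
pose A := Amalgamation comm cover; exists A; split; last first.
  by exists q, t; split; rewrite ?rr2.
have lq x u : link x u -> eqv r x (q (amalg_map A u)).
  case: u => u /=; first by move/sub1=> xu; apply: eqv_trans (b'E u).
  by move/sub2=> xu; apply: eqv_trans (a'E u).
by move=> x y u v /lq xu /lq yv; rewrite (eqv_rel pr xu yv) qr.1.
Qed.

Let amalg_rel (B : amalgamation a b) :
  exists2 r, r \in amalgams r1 r2 & linked B r.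
Proof.
have /fin_all_exists[pi piP] (x : X) : exists o : option (Q + P'),
    if x \in supp r1 :|: supp r2 then if o is Some u then link x u else false
    else ~~ isSome o.
  have [/link_ex[u xu]|_] := boolP (x \in supp r1 :|: supp r2).
    by exists (Some u).
  by exists None.
have lfun1 x y y' : link x (inl y) -> link x (inl y') -> y = y'.
  rewrite /= => xy; rewrite eqv_sym in xy => /(eqv_trans pr1 xy).
  exact: rep_inj.
have lfun2 x y y' : link x (inr y) -> link x (inr y') -> y = y'.
  rewrite /= => xy; rewrite eqv_sym in xy => /(eqv_trans pr2 xy).
  exact: rep_inj.
have lfunx x y z : link x (inl y) -> link x (inr z) ->
    amalg_b B y = amalg_a B z.
  move=> xy xz; have xC : x \in supp (restr r1 C).
    by rewrite supp_restr !in_setI (eqv_supp pr1 xy).1 (eqv_supp pr2 xz).1.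
  have [p pE] := wr.2 _ xC.
  have -> : y = a p.
    apply: (lfun1 x) => //; exact: eqv_trans pr1 (eqv_restr pE) (aE p).
  rewrite amalg_comm; congr (amalg_a B _); rewrite r12 in pE.
  apply/esym/(lfun2 x) => //; exact: eqv_trans pr2 (eqv_restr pE) (bE p).
have lfun x u v : link x u -> link x v -> amalg_map B u = amalg_map B v.
  case: u v => [u|u] [v|v] xu xv /=; first by rewrite (lfun1 _ _ _ xu xv).
  - exact: lfunx xu xv.
  - by apply/esym/(lfunx _ _ _ xv xu).
  - by rewrite (lfun2 _ _ _ xu xv).
pose r := [set p : X * X | if (pi p.1, pi p.2) is (Some u, Some v) then
                    (amalg_map B u <= amalg_map B v)%O else false].
have lr : linked B r.
  move=> x y u v xu yv; rewrite inE /=.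
  have := piP x; rewrite (link_supp xu); case: (pi x) => // u' xu'.
  have := piP y; rewrite (link_supp yv); case: (pi y) => // v' yv'.
  by rewrite (lfun _ _ _ xu xu') (lfun _ _ _ yv yv').
exists r => //.
have rs : supp r = supp r1 :|: supp r2.
  apply/setP=> x; rewrite inE; have := piP x; rewrite [LHS]inE /=.
  by case: ifP => _; case: (pi x) => // u _; rewrite lexx.
have pr : preo r.
  apply/preoP; split=> [x y|y x z]; rewrite !inE /=.
    by case: (pi x) => // u; case: (pi y) => // v; rewrite !lexx.
  case: (pi x) => // u; case: (pi y) => // v; case: (pi z) => // q.
  exact: le_trans.
rewrite inE pr rs eqxx /=; apply/andP; split; apply/eqP/setP=> -[x y].
  rewrite restrE; apply/and3P/idP => [[xy xs ys]|xy].
    have [u xu] := sr.2 _ xs; have [v yv] := sr.2 _ ys.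
    rewrite (eqv_rel pr1 xu yv) sr.1 -(emb_le (amalg_b B)).
    by rewrite -(lr x y (inl u) (inl v)).
  have [xs ys] := preo_supp pr1 xy; split=> //.
  have [u xu] := sr.2 _ xs; have [v yv] := sr.2 _ ys.
  by rewrite (lr x y (inl u) (inl v)) //= emb_le -sr.1 -(eqv_rel pr1 xu yv).
rewrite restrE; apply/and3P/idP => [[xy xs ys]|xy].
  have [u xu] := tr.2 _ xs; have [v yv] := tr.2 _ ys.
  rewrite (eqv_rel pr2 xu yv) tr.1 -(emb_le (amalg_a B)).
  by rewrite -(lr x y (inr u) (inr v)).
have [xs ys] := preo_supp pr2 xy; split=> //.
have [u xu] := tr.2 _ xs; have [v yv] := tr.2 _ ys.
by rewrite (lr x y (inr u) (inr v)) //= emb_le -tr.1 -(eqv_rel pr2 xu yv).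
Qed.

Lemma val_amalg_rep :
  nu a = \sum_(r in amalgams r1 r2) val_rule nu r (supp r2).
Proof.
have /fin_all_exists[A AP] (i : 'I_#|amalgams r1 r2|) :
    exists A : amalgamation a b,
      linked A (enum_val i) /\ model (enum_val i) (supp r2) (amalg_a A).
  by apply: amalg_of; apply: enum_valP.
rewrite big_enum_val (measure_amalg nuP (A := A)).
  apply: eq_bigr => i _; rewrite (val_model (measure_mult nuP) _ (AP i).2) //.
  by have := enum_valP i; rewrite inE => /andP[].
split=> [i j iso|B].
  apply/enum_val_inj/(linked_inj _ _ (iso_linked iso (AP i).1) (AP j).1);
    exact: enum_valP.
have [r rS Br] := amalg_rel B; exists (enum_rank_in rS r).
by apply: (linked_iso Br); have := (AP (enum_rank_in rS r)).1; rewrite enum_rankK_in.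
Qed.

End Link.

Lemma val_amalg :
  val_rule nu r1 C = \sum_(r in amalgams r1 r2) val_rule nu r (supp r2).
Proof.
have [Q [s sr]] := rep_exists pr1; have [P' [t tr]] := rep_exists pr2.
have [P [w wr]] := rep_exists (restr_preo C pr1).
have [a aE] := rep_map pr1 wr sr.
have wr2 := wr; rewrite r12 in wr2; have [b bE] := rep_map pr2 wr2 tr.
rewrite (val_model (measure_mult nuP) (a := a)) //; last by exists s, w.
exact: (val_amalg_rep sr tr wr aE bE).
Qed.

End Amalgamation.

(** * One-point extensions *)

Section OnePoint.
Variable X : finType.
Implicit Types (r s : {set X * X}) (A B C D : {set X}) (x y z : X).

Definition ext s x A B : {set {set X * X}} :=
  [set r | [&& preo r, supp r == x |: supp s, restr r (supp s) == s,
      A \subset [set y | (y, x) \in r] & B \subset [set y | (x, y) \in r]]].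

Lemma extP s x A B r :
  reflect [/\ preo r, supp r = x |: supp s, restr r (supp s) = s,
      forall a, a \in A -> (a, x) \in r & forall b, b \in B -> (x, b) \in r]
    (r \in ext s x A B).
Proof.
rewrite inE; apply: (iffP and5P) => -[pr rs rr rA rB]; split=> //.
- exact/eqP.
- exact/eqP.
- by move/subsetP: rA => rA a /rA; rewrite inE.
- by move/subsetP: rB => rB a /rB; rewrite inE.
- exact/eqP.
- exact/eqP.
- by apply/subsetP=> a /rA; rewrite inE.
- by apply/subsetP=> a /rB; rewrite inE.
Qed.

Lemma supp_refl r x : x \in supp r -> (x, x) \in r.
Proof. by rewrite inE. Qed.

Lemma restr_rel r s D x y : restr r D = s -> x \in D -> y \in D ->
  ((x, y) \in s) = ((x, y) \in r).
Proof. by move=> <- xD yD; rewrite restrE xD yD !andbT. Qed.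

Lemma ext_eq s x A B A' B' r r' : r \in ext s x A B -> r' \in ext s x A' B' ->
  (forall y, y \in supp s -> ((y, x) \in r) = ((y, x) \in r')) ->
  (forall y, y \in supp s -> ((x, y) \in r) = ((x, y) \in r')) -> r = r'.
Proof.
case/extP=> pr rs rr _ _ /extP[pr' rs' rr' _ _] Hl Hu.
apply/setP=> -[y z].
have [ys|ys] := boolP (y \in x |: supp s); last first.
  by apply/idP/idP=> /preo_supp[]//; rewrite ?rs ?rs' (negPf ys).
have [zs|zs] := boolP (z \in x |: supp s); last first.
  by apply/idP/idP=> /preo_supp[]//; rewrite ?rs ?rs' (negPf zs).
case/setU1P: ys => [->|ys]; case/setU1P: zs => [->|zs].
- by rewrite !supp_refl ?rs ?rs' ?setU11.
- exact: Hu.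
- exact: Hl.
- by rewrite -(restr_rel rr) // -(restr_rel rr').
Qed.

Definition pull (g : X -> X) s : {set X * X} := [set u | (g u.1, g u.2) \in s].

Lemma pull_preo (g : X -> X) s : preo s -> preo (pull g s).
Proof.
move=> ps; apply/preoP; split=> [y z|z x y]; rewrite !inE /=.
  by case/(preo_supp ps); rewrite !inE.
exact: preo_trans.
Qed.

(** The preorder obtained by adjoining to [s] a point [x] equivalent to [y]. *)
Definition clone x y s := pull (fun z => if z == x then y else z) s.

Lemma supp_neq x y s : x \notin supp s -> y \in supp s -> (y == x) = false.
Proof. by move=> xs ys; apply: contraNF xs => /eqP <-. Qed.

Lemma clone_eqv s x y : x \notin supp s -> y \in supp s ->
  eqv (clone x y s) x y.
Proof.
move=> xs ys; rewrite /eqv ![_ \in clone _ _ _]inE /= eqxx.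
by rewrite (supp_neq xs) // supp_refl.
Qed.

Lemma cloneP s x y A B : preo s -> x \notin supp s ->
  y \in supp s -> A \subset supp s -> B \subset supp s ->
  (forall a, a \in A -> (a, y) \in s) -> (forall b, b \in B -> (y, b) \in s) ->
  clone x y s \in ext s x A B.
Proof.
move=> ps xs ys As Bs Ay By; apply/extP; split.
- exact: pull_preo.
- apply/setP=> z; rewrite !inE /=; case: eqP => //= _.
  by rewrite inE in ys.
- apply/setP=> -[u v]; rewrite restrE [_ \in clone _ _ _]inE /=.
  have [us|us] := boolP (u \in supp s); last first.
    by rewrite !andbF; apply/esym/negP=> /(preo_supp ps)[]; rewrite (negPf us).
  have [vs|vs] := boolP (v \in supp s); last first.
    by rewrite !andbF; apply/esym/negP=> /(preo_supp ps)[]; rewrite (negPf vs).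
  by rewrite !andbT !(supp_neq xs).
- move=> a aA; rewrite inE /= eqxx (supp_neq xs) ?Ay //.
  exact: (subsetP As).
- move=> b bB; rewrite inE /= eqxx (supp_neq xs) ?By //.
  exact: (subsetP Bs).
Qed.

(** A point equivalent to [y] is comparable to exactly what [y] is, so the
    extension is unique. *)
Lemma ext_clone s x y A B r : preo s -> x \notin supp s -> y \in supp s ->
  r \in ext s x A B -> eqv r x y -> r = clone x y s.
Proof.
move=> ps xs ys rE xy; have [pr rs rr _ _] := extP _ _ _ _ _ rE.
have cE : clone x y s \in ext s x set0 set0.
  by apply: cloneP; rewrite ?sub0set // => z; rewrite in_set0.
apply: (ext_eq rE cE) => z zs; rewrite inE /= eqxx (supp_neq xs) //;
  have zz : eqv r z z by rewrite /eqv supp_refl ?rs ?setU1r.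
  by rewrite (restr_rel rr) // (eqv_rel pr zz xy).
by rewrite (restr_rel rr) // (eqv_rel pr xy zz).
Qed.

Definition antichain s A := forall a a', a \in A -> a' \in A ->
  (a, a') \in s -> a = a'.

(** The rank makes [jrel x A B] a copy of the poset [J p q] on the points of
    [A], [x] and [B]: low points have rank 0, the centre 1, high points 2. *)
Definition jrank x B y : nat := if y \in B then 2%N else (y == x).
Definition jrel x A B : {set X * X} :=
  [set u | [&& u.1 \in x |: (A :|: B), u.2 \in x |: (A :|: B) &
      (u.1 == u.2) || (jrank x B u.1 < jrank x B u.2)%N]].

Lemma supp_jrel x A B : supp (jrel x A B) = x |: (A :|: B).
Proof. by apply/setP=> y; rewrite [LHS]inE [LHS]inE /= eqxx /= andbT andbb. Qed.

Lemma jrel_preo x A B : preo (jrel x A B).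
Proof.
apply/preoP; split=> [y z|z x' y].
  by rewrite supp_jrel inE /= => /and3P[-> ->].
rewrite ![_ \in jrel _ _ _]inE /= => /and3P[-> _ /orP[/eqP <-|xz]].
  by case/and3P=> _ -> ->.
case/and3P=> _ -> /orP[/eqP <-|zy]; first by rewrite xz orbT.
by rewrite (ltn_trans xz zy) orbT.
Qed.

Section Bipartite.
Variables (s : {set X * X}) (x : X) (A B : {set X}).
Hypotheses (ps : preo s) (xs : x \notin supp s) (sAB : supp s = A :|: B).
Hypotheses (Ach : antichain s A) (Bch : antichain s B).
Hypothesis AB : forall a b, a \in A -> b \in B -> (a, b) \in s.
Hypothesis BA : forall a b, a \in A -> b \in B -> (b, a) \notin s.

Let As : A \subset supp s. Proof. by rewrite sAB subsetUl. Qed.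
Let Bs : B \subset supp s. Proof. by rewrite sAB subsetUr. Qed.

Lemma bip_notin : x \notin A :|: B. Proof. by rewrite -sAB. Qed.

Let ABF a : a \in A -> a \in B -> False.
Proof. by move=> aA aB; have := BA aA aB; rewrite AB. Qed.

Lemma jrel_ext : jrel x A B \in ext s x A B.
Proof.
have [xA xB] : x \notin A /\ x \notin B.
  by apply/andP; rewrite -negb_or -in_setU bip_notin.
apply/extP; split.
- exact: jrel_preo.
- by rewrite supp_jrel sAB.
- apply/setP=> -[u v]; rewrite restrE [_ \in jrel _ _ _]inE /=.
  have [us|us] := boolP (u \in supp s); last first.
    by rewrite !andbF; apply/esym/negP=> /(preo_supp ps)[]; rewrite (negPf us).
  have [vs|vs] := boolP (v \in supp s); last first.
    by rewrite !andbF; apply/esym/negP=> /(preo_supp ps)[]; rewrite (negPf vs).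
  rewrite !andbT -sAB !setU1r //= /jrank !(supp_neq xs) //.
  have [->|uv] := eqVneq u v; first by rewrite supp_refl.
  move: us vs; rewrite sAB => /setUP[uA|uB] /setUP[vA|vB].
  + rewrite (introF idP (ABF uA)) (introF idP (ABF vA)) /=.
    by apply/esym/negP=> /(Ach uA vA)/eqP; rewrite (negPf uv).
  + by rewrite (introF idP (ABF uA)) vB AB.
  + by rewrite uB (introF idP (ABF vA)) (negPf (BA vA uB)).
  + rewrite uB vB /=.
    by apply/esym/negP=> /(Bch uB vB)/eqP; rewrite (negPf uv).
- move=> a aA; rewrite inE /= setU11 setU1r ?inE ?aA //= /jrank.
  rewrite (introF idP (ABF aA)) (negPf xB) eqxx (supp_neq xs) ?orbT //.
  exact: (subsetP As).
- move=> b bB; rewrite inE /= setU11 setU1r ?inE ?bB ?orbT //= /jrank.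
  by rewrite bB (negPf xB) eqxx orbT.
Qed.

Lemma jrel_up y : y \in A -> (x, y) \notin jrel x A B.
Proof.
move=> yA; rewrite inE /= /jrank (introF idP (ABF yA)).
rewrite eq_sym (supp_neq xs) ?ltn0 ?andbF //.
exact: (subsetP As).
Qed.

Lemma jrel_down y : y \in B -> (y, x) \notin jrel x A B.
Proof.
move=> yB; rewrite inE /= /jrank yB (supp_neq xs) ?(subsetP Bs) //=.
have := bip_notin; rewrite in_setU negb_or => /andP[_ /negPf ->].
by rewrite eqxx !andbF.
Qed.

(** The points onto which [x] may fall. *)
Definition mids := [set y in supp s |
  (A \subset [set a | (a, y) \in s]) && (B \subset [set b | (y, b) \in s])].

Lemma midsP y : reflect [/\ y \in supp s, forall a, a \in A -> (a, y) \in s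
  & forall b, b \in B -> (y, b) \in s] (y \in mids).
Proof.
rewrite [y \in mids]in_set; apply: (iffP and3P) => -[ys yA yB]; split=> //.
- by move/subsetP: yA => yA a /yA; rewrite inE.
- by move/subsetP: yB => yB a /yB; rewrite inE.
- by apply/subsetP=> a /yA; rewrite inE.
- by apply/subsetP=> a /yB; rewrite inE.
Qed.

(** A point of an antichain dominates it only if it is its sole element. *)
Lemma mids_card : #|mids| = ((#|A| == 1) + (#|B| == 1))%N.
Proof.
have -> : mids = (if #|A| == 1%N then A else set0)
                 :|: (if #|B| == 1%N then B else set0).
  apply/setP=> y; rewrite in_setU; apply/midsP/orP => [[]|[]].
  - rewrite sAB => /setUP[yA|yB] Ay By; [left|right].
      have -> : A = [set y]; last by rewrite cards1 eqxx inE.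
      apply/setP=> a; rewrite inE; apply/idP/eqP => [aA|-> //].
      exact: Ach (Ay a aA).
    have -> : B = [set y]; last by rewrite cards1 eqxx inE.
    apply/setP=> b; rewrite inE; apply/idP/eqP => [bB|-> //].
    exact/esym/Bch/By.
  - case: ifP => [/cards1P[a Aa]|_]; last by rewrite inE.
    rewrite Aa inE => /eqP ->; have aA : a \in A by rewrite Aa inE.
    split; first exact: (subsetP As).
      by move=> a'; rewrite inE => /eqP ->; rewrite supp_refl ?(subsetP As).
    by move=> b; apply: AB.
  - case: ifP => [/cards1P[b Bb]|_]; last by rewrite inE.
    rewrite Bb inE => /eqP ->; have bB : b \in B by rewrite Bb inE.
    split; first exact: (subsetP Bs).
      by move=> a aA; apply: AB.
    by move=> b'; rewrite inE => /eqP ->; rewrite supp_refl ?(subsetP Bs).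
have dAB : A :&: B = set0.
  by apply/setP=> y; rewrite !inE; apply/negP=> /andP[]; apply: ABF.
rewrite cardsU; do 2![case: ifP => [/eqP ?|_]];
  by rewrite ?dAB ?set0I ?setI0 ?cards0 ?subn0 //; congr addn.
Qed.

Lemma mids_jrel y : y \in mids -> clone x y s != jrel x A B.
Proof.
case/midsP=> ys _ _; apply/eqP=> e.
have [xy yx] : (x, y) \in clone x y s /\ (y, x) \in clone x y s.
  by rewrite !inE /= eqxx (supp_neq xs) //; move: ys; rewrite inE.
rewrite e in xy yx.
move: ys; rewrite sAB => /setUP[yA|yB].
  by have := jrel_up yA; rewrite xy.
by have := jrel_down yB; rewrite yx.
Qed.

Lemma clone_inj : {in mids &, injective (fun y => clone x y s)}.
Proof.
move=> y z /midsP[ys yA yB] /midsP[zs zA zB] /setP e.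
have yz : (y, z) \in s.
  have := e (y, x); rewrite !inE /= eqxx (supp_neq xs) // => <-.
  by move: ys; rewrite inE.
have zy : (z, y) \in s.
  have := e (z, x); rewrite !inE /= eqxx (supp_neq xs) // => ->.
  by move: zs; rewrite inE.
move: ys zs; rewrite sAB => /setUP[y1|y1] /setUP[z1|z1].
- exact: Ach yz.
- by have := BA y1 z1; rewrite zy.
- by have := BA z1 y1; rewrite yz.
- exact: Bch yz.
Qed.

(** As [x] is above all of [A] and below all of [B], its position can only be
    changed by putting it below some [a] or above some [b]; it is then
    equivalent to that point. *)
Lemma ext_bip : ext s x A B = jrel x A B |: [set clone x y s | y in mids].
Proof.
apply/setP=> r; apply/idP/setU1P => [rE|]; last first.
  case=> [->|/imsetP[y /midsP[ys yA yB] ->]]; first exact: jrel_ext.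
  exact: cloneP.
have [pr rs rr rA rB] := extP _ _ _ _ _ rE.
have xyE y : y \in supp s -> eqv r x y -> r \in [set clone x y s | y in mids].
  move=> ys xy; rewrite (ext_clone ps xs ys rE xy); apply: imset_f.
  case/andP: xy => xy yx; apply/midsP; split=> // [a aA|b bB].
    rewrite (restr_rel rr) ?(subsetP As a aA) //.
    exact: preo_trans pr (rA a aA) xy.
  rewrite (restr_rel rr) ?(subsetP Bs b bB) //.
  exact: preo_trans pr yx (rB b bB).
have [/exists_inP[a aA xa]|nA] := boolP [exists a in A, (x, a) \in r].
  by right; apply: (xyE a); rewrite ?(subsetP As) // /eqv xa rA.
have [/exists_inP[b bB bx]|nB] := boolP [exists b in B, (b, x) \in r].
  by right; apply: (xyE b); rewrite ?(subsetP Bs) // /eqv bx rB.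
have [_ _ _ jA jB] := extP _ _ _ _ _ jrel_ext.
left; apply: (ext_eq rE jrel_ext) => y; rewrite sAB => /setUP[y1|y1].
- by rewrite rA ?jA.
- rewrite (negPf (jrel_down y1)); apply/negP=> yx.
  by move/negP: nB; apply; apply/exists_inP; exists y.
- rewrite (negPf (jrel_up y1)); apply/negP=> yx.
  by move/negP: nA; apply; apply/exists_inP; exists y.
- by rewrite rB ?jB.
Qed.

End Bipartite.
End OnePoint.

(** * Sums over one-point extensions *)

Definition valuation (k : fieldType) : Type :=
  forall X : finType, {set X * X} -> {set X} -> k.

(** What the sequel needs of a measure [nu], for [V] its values [val_rule nu]
    and [N p q] its value at [J p q]. Stated for preorders, these conditions are
    stable under reversal without any recourse to opposite posets. *)
Record is_valuation (k : fieldType) (V : valuation k) (N : nat -> nat -> k) :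
  Prop := IsValuation {
  v_equiv : forall (X : finType) (r : {set X * X}) (D : {set X}), preo r ->
    (forall e, e \in supp r -> exists2 d, d \in D & eqv r e d) ->
    V X r D = 1;
  v_mul : forall (X : finType) (r : {set X * X}) (C D : {set X}), preo r ->
    C \subset D -> V X r C = V X (restr r D) C * V X r D;
  v_amalg : forall (X : finType) (r1 r2 : {set X * X}), preo r1 -> preo r2 ->
    let C := supp r1 :&: supp r2 in restr r1 C = restr r2 C ->
    V X r1 C = \sum_(r in amalgams r1 r2) V X r (supp r2);
  v_jrel : forall (X : finType) (x : X) (A B : {set X}), x \notin A :|: B ->
    [disjoint A & B] -> V X (jrel x A B) (A :|: B) = N #|A| #|B| }.

(** The sum of a measure over the points that may be adjoined between two
    antichains of sizes [p] and [q]; see [extsum_antichain]. *)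
Definition fval (k : fieldType) (N : nat -> nat -> k) p q : k :=
  N p q + (p == 1%N)%:R + (q == 1%N)%:R.

Section Valuation.
Variables (k : fieldType) (V : valuation k) (N : nat -> nat -> k).
Hypothesis VP : is_valuation V N.
Notation f := (fval N).

Section Fixed.
Variable X : finType.
Implicit Types (r s : {set X * X}) (A B C D : {set X}) (x y z : X).

Definition extsum s x A B : k := \sum_(r in ext s x A B) V r (supp s).

Lemma restr_setU1 s r x C : restr r (supp s) = s -> C \subset supp s ->
  restr (restr r (x |: C)) C = restr s C.
Proof.
move=> rr Cs; rewrite -[in RHS]rr !restr_restr (setIidPl Cs).
by rewrite (setIidPl _) ?subsetUr.
Qed.

(** Each extension of [s] restricts to an extension of [restr s C], and those
    with a given restriction are its amalgamations with [s]; the amalgamation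
    axiom sums their values. *)
Lemma extsum_restr s x A B C : preo s -> x \notin supp s -> C \subset supp s ->
  A \subset C -> B \subset C -> extsum s x A B = extsum (restr s C) x A B.
Proof.
move=> ps xs Cs AC BC.
have sC : supp (restr s C) = C by rewrite supp_restr; apply/setIidPr.
have sxC : (x |: C) :&: supp s = C.
  apply/setP=> y; rewrite in_setI in_setU1; have [->|_] /= := eqVneq y x.
    by rewrite (negPf xs); apply/esym/negP=> /(subsetP Cs); rewrite (negPf xs).
  by apply/andP/idP=> [[]|yC] //; split=> //; apply: (subsetP Cs).
rewrite /extsum sC (partition_big (fun r => restr r (x |: C))
  (mem (ext (restr s C) x A B))) /=; last first.
  move=> r /extP[pr rs rr rA rB]; apply/extP; split.
  - exact: restr_preo.
  - rewrite supp_restr rs sC; apply/setIidPr.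
    by rewrite setUS.
  - by rewrite sC (restr_setU1 _ rr).
  - by move=> a aA; rewrite restrE rA // setU11 setU1r // (subsetP AC).
  - by move=> b bB; rewrite restrE rB // setU11 setU1r // (subsetP BC).
apply: eq_bigr => r' /extP[pr' rs' rr' rA' rB'].
have r's : supp r' :&: supp s = C by rewrite rs' sC.
have -> : V r' C = \sum_(r in amalgams r' s) V r (supp s).
  by rewrite -{1}r's (v_amalg VP) //= r's -[RHS]rr' sC.
apply: eq_bigl => r; rewrite [r \in amalgams _ _]inE rs' sC.
have xCs : x |: C :|: supp s = x |: supp s.
  by rewrite -setUA (setUidPr Cs).
rewrite xCs; apply/andP/and4P => [[/extP[pr rs rr rA rB] rx]|[pr rs rx rr]].
  by rewrite pr rs rr rx.
split=> //; move/eqP: rx => rx; apply/extP; split=> //; try exact/eqP.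
  by move=> a /rA'; rewrite -rx restrE => /and3P[].
by move=> b /rB'; rewrite -rx restrE => /and3P[].
Qed.

(** The preorders are sorted by their restriction to the complement of [x],
    and the values factor through it. *)
Lemma extsum_step (E : {set X}) x A B D (S : {set {set X * X}}) :
  x \notin E -> D \subset E ->
  (forall s, s \in S -> preo s /\ supp s = E) ->
  \sum_(r | [&& preo r, supp r == x |: E, restr r E \in S,
       A \subset [set y | (y, x) \in r] & B \subset [set y | (x, y) \in r]])
     V r D
  = \sum_(s in S) V s D * extsum s x A B.
Proof.
move=> xE DE SP; rewrite (partition_big (fun r => restr r E) (mem S)) /=; last first.
  by move=> r /and5P[].
apply: eq_bigr => s sS; have [ps sE] := SP s sS.
rewrite mulr_sumr; apply: eq_big => [r|r].
  rewrite inE sE; have [->|_] := eqVneq (restr r E) s; last by rewrite !andbF.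
  by rewrite sS andbT.
by case/andP=> /and5P[pr _ _ _ _] /eqP rE; rewrite (v_mul VP pr DE) sE rE.
Qed.

Lemma extsum_equiv s x y A B : preo s -> x \notin supp s -> y \in supp s ->
  A \subset supp s -> B \subset supp s ->
  (forall a, a \in A -> (a, y) \in s) -> (forall b, b \in B -> (y, b) \in s) ->
  (forall r, r \in ext s x A B -> eqv r x y) -> extsum s x A B = 1.
Proof.
move=> ps xs ys As Bs yA yB xy.
have cE := cloneP ps xs ys As Bs yA yB.
rewrite /extsum (_ : ext s x A B = [set clone x y s]); last first.
  apply/setP=> r; rewrite in_set1; apply/idP/eqP => [rE|-> //].
  exact: ext_clone ps xs ys rE (xy r rE).
rewrite big_set1; have [pr rs _ _ _] := extP _ _ _ _ _ cE.
rewrite (v_equiv VP) // => e; rewrite rs => /setU1P[->|es].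
  by exists y => //; apply: xy.
by exists e => //; rewrite /eqv supp_refl // rs setU1r.
Qed.

(** If the bounds force [x] to be equivalent to a point, there is a unique
    extension. *)
Lemma extsum_meet s x a b A B : preo s -> x \notin supp s ->
  A \subset supp s -> B \subset supp s ->
  (forall a b, a \in A -> b \in B -> (a, b) \in s) ->
  a \in A -> b \in B -> (b, a) \in s -> extsum s x A B = 1.
Proof.
move=> ps xs As Bs AB aA bB ba; apply: (@extsum_equiv s x a) => //.
- exact: (subsetP As).
- by move=> a' a'A; apply: preo_trans ps (AB a' b a'A bB) ba.
- by move=> b' b'B; apply: AB.
move=> r /extP[pr rs rr rA rB]; rewrite /eqv rA // andbT.
apply: preo_trans pr (rB b bB) _.
by rewrite -(restr_rel rr) ?(subsetP As _ aA) ?(subsetP Bs _ bB).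
Qed.

(** After restriction to [A :|: B] the extensions are those of [ext_bip]: one
    contributes [N #|A| #|B|], the others 1 each. *)
Lemma extsum_antichain s x A B : preo s -> x \notin supp s ->
  A \subset supp s -> B \subset supp s ->
  antichain s A -> antichain s B ->
  (forall a b, a \in A -> b \in B -> (a, b) \in s) ->
  (forall a b, a \in A -> b \in B -> (b, a) \notin s) ->
  extsum s x A B = f #|A| #|B|.
Proof.
move=> ps xs As Bs Ach Bch AB BA.
rewrite (@extsum_restr s x A B (A :|: B)) ?subsetUl ?subsetUr //; last first.
  by rewrite subUset As.
set s' := restr s _; have ps' : preo s' by apply: restr_preo.
have s's : supp s' = A :|: B.
  by rewrite supp_restr; apply/setIidPr; rewrite subUset As.
have xs' : x \notin supp s'.
  by apply: contra xs; rewrite supp_restr => /setIP[].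
have Ach' : antichain s' A.
  by move=> a a' aA a'A; rewrite restrE => /and3P[/Ach ->].
have Bch' : antichain s' B.
  by move=> a a' aA a'A; rewrite restrE => /and3P[/Bch ->].
have AB' a b : a \in A -> b \in B -> (a, b) \in s'.
  by move=> aA bB; rewrite restrE AB // !in_setU aA bB orbT.
have BA' a b : a \in A -> b \in B -> (b, a) \notin s'.
  by move=> aA bB; rewrite restrE negb_and BA.
rewrite /extsum (ext_bip ps' xs' s's Ach' Bch' AB' BA') big_setU1 /=; last first.
  apply/negP=> /imsetP[y ym /esym/eqP].
  by rewrite (negPf (mids_jrel xs' s's AB' BA' ym)).
rewrite big_imset /=; last exact: clone_inj xs' s's Ach' Bch' BA'.
rewrite s's (v_jrel VP); last 2 first.
- by rewrite -s's.
- apply/pred0P=> y /=; apply/negP=> /andP[yA yB].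
  by have := BA' _ _ yA yB; rewrite AB'.
rewrite /fval -addrA -natrD -(mids_card s's Ach' Bch' AB') //; congr (_ + _).
rewrite (eq_bigr (fun=> 1)) ?sumr_const // => y /midsP[ys yA yB].
have As' : A \subset supp s' by rewrite s's subsetUl.
have Bs' : B \subset supp s' by rewrite s's subsetUr.
have [pr rs _ _ _] := extP _ _ _ _ _ (cloneP ps' xs' ys As' Bs' yA yB).
rewrite (v_equiv VP) // => e; rewrite rs => /setU1P[->|es].
  exists y; first by rewrite -s's.
  exact: clone_eqv.
exists e; first by rewrite -s's.
by rewrite /eqv supp_refl // rs setU1r.
Qed.

Lemma extsum_drop_low s x A B a a' : preo s -> a \in A -> a' \in A ->
  A \subset supp s -> a != a' -> (a, a') \in s ->
  extsum s x A B = extsum s x (A :\ a) B.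
Proof.
move=> ps aA a'A As aa' le; apply: eq_bigl => r.
apply/extP/extP => -[pr rs rr rA rB]; split=> // c.
  by case/setD1P=> _; apply: rA.
have [->|ca] := eqVneq c a; last by move=> cA; apply: rA; rewrite !inE ca.
move=> _; apply: (@preo_trans _ _ a') => //.
  by rewrite -(restr_rel rr) // (subsetP As).
by apply: rA; rewrite !inE eq_sym aa'.
Qed.

Lemma extsum_drop_up s x A B b b' : preo s -> b \in B -> b' \in B ->
  B \subset supp s -> b != b' -> (b', b) \in s ->
  extsum s x A B = extsum s x A (B :\ b).
Proof.
move=> ps bB b'B Bs bb' le; apply: eq_bigl => r.
apply/extP/extP => -[pr rs rr rA rB]; split=> // c.
  by case/setD1P=> _; apply: rB.
have [->|cb] := eqVneq c b; last by move=> cB; apply: rB; rewrite !inE cb.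
move=> _; apply: (@preo_trans _ _ b') => //; last first.
  by rewrite -(restr_rel rr) // (subsetP Bs).
by apply: rB; rewrite !inE eq_sym bb'.
Qed.

(** Non-minimal elements of [B] bound nothing new and may be discarded. If an
    element of [B] is then below one of [A], [x] has to fall on it and the sum
    is 1; otherwise [B] has become an antichain of some size [q]. *)
Lemma extsum_low_antichain s x A B : preo s -> x \notin supp s ->
  A \subset supp s -> B \subset supp s ->
  (forall a b, a \in A -> b \in B -> (a, b) \in s) -> antichain s A ->
  [/\ (0 < #|A|)%N, (0 < #|B|)%N & extsum s x A B = 1] \/
  exists q, [/\ (q <= #|B|)%N, (0 < q)%N = (0 < #|B|)%N
              & extsum s x A B = f #|A| q].
Proof.
move=> ps xs As; have [n] := ubnP #|B|; elim: n B => // n IHn B ltBn Bs AB Ach.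
have [/existsP[b /existsP[b' /and4P[bB b'B bb' le]]]|Bch] :=
  boolP [exists b, exists b',
    [&& b \in B, b' \in B, b != b' & (b', b) \in s]].
  rewrite (extsum_drop_up _ _ ps bB b'B Bs bb' le).
  have cB : #|B| = #|B :\ b|.+1 by rewrite (cardsD1 b) bB.
  have sub : B :\ b \subset supp s by apply: subset_trans Bs; apply: subD1set.
  have lt_n : (#|B :\ b| < n)%N by move: ltBn; rewrite cB ltnS.
  case: (IHn (B :\ b)) => //.
  - by move=> a c aA /setD1P[_]; apply: AB.
  - case=> A0 B0 E; left; split=> //; apply/card_gt0P; exists b'; exact: b'B.
  - move=> [q [qB q0 ->]]; right; exists q; split=> //.
      by rewrite cB leqW.
    rewrite q0 cB /=; apply/card_gt0P; exists b'.
    by rewrite !inE eq_sym bb'.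
have [/existsP[a /existsP[b /and3P[aA bB ba]]]|BA] :=
  boolP [exists a, exists b, [&& a \in A, b \in B & (b, a) \in s]].
  left; split; last exact: extsum_meet ba.
    by apply/card_gt0P; exists a.
  by apply/card_gt0P; exists b.
right; exists #|B|; split=> //; apply: extsum_antichain => //.
  move=> b b' bB b'B le; apply/eqP; apply: contraR Bch => bb'.
  by apply/existsP; exists b'; apply/existsP; exists b; rewrite b'B bB eq_sym bb'.
move=> a b aA bB; apply: contra BA => ba.
by apply/existsP; exists a; apply/existsP; exists b; rewrite aA bB.
Qed.

(** A function of the emptiness of the bounds that computes [f] computes all
    the sums: redundant bounds may be discarded one by one. *)
Lemma extsum_bits (K : bool -> bool -> k) s x A B :
  K true true = 1 -> (forall p q, f p q = K (0 < p)%N (0 < q)%N) ->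
  preo s -> x \notin supp s -> A \subset supp s -> B \subset supp s ->
  (forall a b, a \in A -> b \in B -> (a, b) \in s) ->
  extsum s x A B = K (0 < #|A|)%N (0 < #|B|)%N.
Proof.
move=> K1 fK ps xs + Bs; have [n] := ubnP #|A|.
elim: n A => // n IHn A ltAn As AB.
have [/existsP[a /existsP[a' /and4P[aA a'A aa' le]]]|Ach] :=
  boolP [exists a, exists a',
    [&& a \in A, a' \in A, a != a' & (a, a') \in s]].
  rewrite (extsum_drop_low _ _ ps aA a'A As aa' le).
  have cA : #|A| = #|A :\ a|.+1 by rewrite (cardsD1 a) aA.
  have lt_n : (#|A :\ a| < n)%N by move: ltAn; rewrite cA ltnS.
  have sub : A :\ a \subset supp s by apply: subset_trans As; apply: subD1set.
  rewrite (IHn (A :\ a) lt_n sub); last by move=> c b /setD1P[_]; apply: AB.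
  congr (K _ _); rewrite cA /=; apply/card_gt0P; exists a'.
  by rewrite !inE eq_sym aa'.
case: (@extsum_low_antichain s x A B ps xs As Bs AB).
- move=> a a' aA a'A le; apply/eqP; apply: contraR Ach => aa'.
  by apply/existsP; exists a; apply/existsP; exists a'; rewrite aA a'A aa'.
- by case=> A0 B0 ->; rewrite A0 B0.
by case=> q [_ q0 ->]; rewrite fK q0.
Qed.

(** Two points are inserted, [a] between [Z] and [W], and [x] above [a] and [A]
    and below [B]. Both sides are the sum of the values of the resulting
    extensions of [s]: on the left [x] is adjoined first, on the right [a]. *)
Lemma extsum_exchange s x a A B (Z W : {set X}) (c : k) : preo s -> x \notin supp s ->
  a \notin supp s -> a != x -> A \subset supp s -> B \subset supp s ->
  Z \subset supp s -> W \subset supp s ->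
  (forall r, r \in ext s x (A :|: Z) B -> extsum r a Z (x |: W) = 1) ->
  (forall r, r \in ext s a Z (B :|: W) -> extsum r x (a |: A) B = c) ->
  extsum s x (A :|: Z) B = extsum s a Z (B :|: W) * c.
Proof.
move=> ps xs as_ ax As Bs Zs Ws Hx Ha.
have ha : a \notin x |: supp s by rewrite in_setU1 negb_or ax.
have hx : x \notin a |: supp s by rewrite in_setU1 negb_or eq_sym ax.
have hD y : supp s \subset y |: supp s by apply: subsetUr.
transitivity (\sum_(r in ext s x (A :|: Z) B)
    V r (supp s) * extsum r a Z (x |: W)).
  by apply: eq_bigr => r rE; rewrite Hx // mulr1.
transitivity (\sum_(r in ext s a Z (B :|: W))
    V r (supp s) * extsum r x (a |: A) B); last first.
  by rewrite [in RHS]/extsum mulr_suml; apply: eq_bigr => r rE; rewrite Ha.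
rewrite -(extsum_step _ _ ha (hD x)); last by move=> r /extP[].
rewrite -(extsum_step _ _ hx (hD a)); last by move=> r /extP[].
apply: eq_bigl => r.
have rrs y : restr (restr r (y |: supp s)) (supp s) = restr r (supp s).
  by rewrite restr_restr (setIidPl (hD y)).
have suppE y z : preo r -> supp r = y |: (z |: supp s) ->
    supp (restr r (z |: supp s)) = z |: supp s.
  by move=> pr rs; rewrite supp_restr rs; apply/setIidPr/subsetUr.
apply/and5P/and5P => -[pr /eqP rs /extP[_ _ rr rA rB] /subsetP r1 /subsetP r2].
- rewrite rrs in rr.
  have xa : (a, x) \in r by have := r2 x; rewrite !inE eqxx; apply.
  have lowZ z : z \in Z -> (z, a) \in r by move=> /r1; rewrite inE.
  have upW w : w \in W -> (a, w) \in r.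
    by move=> wW; have := r2 w; rewrite !inE wW orbT; apply.
  have lowA y : y \in A -> (y, x) \in r.
    by move=> yA; have := rA y; rewrite in_setU yA restrE => /(_ isT)/andP[].
  have upB b : b \in B -> (x, b) \in r.
    by move=> bB; have := rB b bB; rewrite restrE => /andP[].
  split=> //.
  + by rewrite rs setUCA.
  + apply/extP; split.
    * exact: restr_preo.
    * by apply: (suppE x) => //; rewrite rs setUCA.
    * by rewrite rrs.
    * by move=> z zZ; rewrite restrE lowZ // setU11 setU1r // (subsetP Zs).
    * move=> b bBW; rewrite restrE setU11 andTb.
      case/setUP: bBW => [bB|bW]; last by rewrite upW // setU1r // (subsetP Ws).
      by rewrite (preo_trans pr xa (upB b bB)) setU1r // (subsetP Bs).
  + by apply/subsetP=> y /setU1P[->|yA]; rewrite inE ?xa ?lowA.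
  + by apply/subsetP=> b bB; rewrite inE upB.
- rewrite rrs in rr.
  have xa : (a, x) \in r by have := r1 a; rewrite !inE eqxx; apply.
  have lowA y : y \in A -> (y, x) \in r.
    by move=> yA; have := r1 y; rewrite !inE yA orbT; apply.
  have upB b : b \in B -> (x, b) \in r by move=> /r2; rewrite inE.
  have lowZ z : z \in Z -> (z, a) \in r.
    by move=> zZ; have := rA z zZ; rewrite restrE => /andP[].
  have upW w : w \in W -> (a, w) \in r.
    by move=> wW; have := rB w; rewrite in_setU wW orbT restrE => /(_ isT)/andP[].
  split=> //.
  + by rewrite rs setUCA.
  + apply/extP; split.
    * exact: restr_preo.
    * by apply: (suppE a) => //; rewrite rs setUCA.
    * by rewrite rrs.
    * move=> y yAZ; rewrite restrE setU11 andbT.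
      case/setUP: yAZ => [yA|yZ]; first by rewrite lowA // setU1r // (subsetP As).
      by rewrite (preo_trans pr (lowZ y yZ) xa) setU1r // (subsetP Zs).
    * by move=> b bB; rewrite restrE upB // setU11 setU1r // (subsetP Bs).
  + by apply/subsetP=> z zZ; rewrite inE lowZ.
  + by apply/subsetP=> w /setU1P[->|wW]; rewrite inE ?xa ?upW.
Qed.

End Fixed.
End Valuation.

(** * Inserting two points in both orders *)

Section Insertion.
Variables (k : fieldType) (V : valuation k) (N : nat -> nat -> k).
Hypothesis VP : is_valuation V N.
Notation f := (fval N).
Variables (p q m : nat).
Hypothesis m_gt0 : (0 < m)%N.

(* The points z are the booleans, followed by the a_i, the b_j and the w_l. The
   order is generated by z < b, z < w and a_i < b. *)
Let Y : finType := ((bool + 'I_p) + ('I_q + 'I_m))%type.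
Let X : finType := option (option Y).
Let lt (y z : Y) : bool := match y, z with
  | inl (inl _), inr _ => true
  | inl (inr _), inr (inl _) => true
  | _, _ => false end.
Let s : {set X * X} := [set u | match u.1, u.2 with
  | Some (Some y), Some (Some z) => (y == z) || lt y z
  | _, _ => false end].
Let pz b : X := Some (Some (inl (inl b))).
Let pa i : X := Some (Some (inl (inr i))).
Let pb j : X := Some (Some (inr (inl j))).
Let pw l : X := Some (Some (inr (inr l))).
Let Z := [set pz b | b in {: bool}].
Let A := [set pa i | i in 'I_p].
Let B := [set pb i | i in 'I_q].
Let W := [set pw i | i in 'I_m].
Let x : X := None.
Let a : X := Some None.

Let sE y z : ((Some (Some y), Some (Some z)) \in s) = (y == z) || lt y z.
Proof. by rewrite inE. Qed.

Let ps : preo s.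
Proof.
apply/preoP; split=> [[[y|]|] [[z|]|]|[[y|]|] [[z|]|] [[t|]|]]; rewrite !inE //=.
  by rewrite !eqxx.
case/orP=> [/eqP -> //|zy] /orP[/eqP <-|yt]; first by rewrite zy orbT.
by case: z y t zy yt => [[?|?]|[?|?]] [[?|?]|[?|?]] [[?|?]|[?|?]].
Qed.

Let suppY (y : Y) : (Some (Some y) : X) \in supp s.
Proof. by rewrite inE sE eqxx. Qed.

Let xs : x \notin supp s. Proof. by rewrite !inE. Qed.
Let as_ : a \notin supp s. Proof. by rewrite !inE. Qed.

Let Zs : Z \subset supp s.
Proof. by apply/subsetP=> _ /imsetP[b _ ->]; exact: suppY. Qed.
Let As : A \subset supp s.
Proof. by apply/subsetP=> _ /imsetP[b _ ->]; exact: suppY. Qed.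
Let Bs : B \subset supp s.
Proof. by apply/subsetP=> _ /imsetP[b _ ->]; exact: suppY. Qed.
Let Ws : W \subset supp s.
Proof. by apply/subsetP=> _ /imsetP[b _ ->]; exact: suppY. Qed.

Let cZ : #|Z| = 2%N. Proof. by rewrite card_imset ?card_bool // => b c [->]. Qed.
Let cA : #|A| = p. Proof. by rewrite card_imset ?card_ord // => b c [->]. Qed.
Let cB : #|B| = q. Proof. by rewrite card_imset ?card_ord // => b c [->]. Qed.
Let cW : #|W| = m. Proof. by rewrite card_imset ?card_ord // => b c [->]. Qed.

Let some_some_eq (y z : Y) : y = z -> Some (Some y) = Some (Some z) :> X.
Proof. by move->. Qed.

Let achL : antichain s (A :|: Z).
Proof.
by move=> u v /setUP[] /imsetP[b _ ->] /setUP[] /imsetP[c _ ->];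
  rewrite sE orbF => /eqP/some_some_eq.
Qed.

Let achU : antichain s (B :|: W).
Proof.
by move=> u v /setUP[] /imsetP[b _ ->] /setUP[] /imsetP[c _ ->];
  rewrite sE orbF => /eqP/some_some_eq.
Qed.

Let cAZ : #|A :|: Z| = p.+2.
Proof.
rewrite cardsU cA cZ addn2 (_ : A :&: Z = set0) ?cards0 ?subn0 //.
by apply/setP=> u; rewrite !inE; apply/andP=> -[/imsetP[b _ ->] /imsetP[c _]].
Qed.

Let cBW : #|B :|: W| = (q + m)%N.
Proof.
rewrite cardsU cB cW (_ : B :&: W = set0) ?cards0 ?subn0 //.
by apply/setP=> u; rewrite !inE; apply/andP=> -[/imsetP[b _ ->] /imsetP[c _]].
Qed.

(** With [x] present, [a] is bounded below by two points and above by [x] and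
    the [w], which has at least one and at most [m.+1] minimal elements, so the
    hypothesis gives the sum over [a] the value 1. With [a] present, [a] and
    the [a_i] are an antichain whatever the position of [a], since [a_i <= a]
    would imply [a_i <= w]: the lower bound of [x] then has size [p.+1]. *)
Lemma fval_insert :
  (forall n, (0 < n <= m.+1)%N -> f 2 n = 1) ->
  f p.+2 q = f 2 (q + m) * f p.+1 q.
Proof.
move=> f2.
have achS (S T : {set X}) : S \subset T -> antichain s T -> antichain s S.
  by move=> /subsetP ST Tch u v /ST uT /ST vT; apply: Tch.
rewrite -cAZ -{1}cB -cBW -cZ.
rewrite -(extsum_antichain VP ps xs) //; last 4 first.
- by rewrite subUset As.
- by apply: achS achU; apply: subsetUl.
- by move=> u v /setUP[] /imsetP[b _ ->] /imsetP[c _ ->]; rewrite sE.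
- by move=> u v /setUP[] /imsetP[b _ ->] /imsetP[c _ ->]; rewrite sE.
rewrite -(extsum_antichain VP ps as_) //; last 4 first.
- by rewrite subUset Bs.
- by apply: achS achL; apply: subsetUr.
- by move=> u v /imsetP[b _ ->] /setUP[] /imsetP[c _ ->]; rewrite sE.
- by move=> u v /imsetP[b _ ->] /setUP[] /imsetP[c _ ->]; rewrite sE.
apply: (extsum_exchange VP ps xs as_ _ As Bs Zs Ws) => //.
  move=> r /extP[pr rs rr rA rB].
  have Zr : Z \subset supp r by rewrite rs (subset_trans Zs) ?subsetUr.
  have Wr : W \subset supp r by rewrite rs (subset_trans Ws) ?subsetUr.
  case: (@extsum_low_antichain _ _ _ VP _ r a Z (x |: W)) => //.
  - by rewrite rs in_setU1.
  - by rewrite subUset Wr andbT sub1set rs setU11.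
  - move=> z w zZ /setU1P[->|wW]; first by apply: rA; rewrite in_setU zZ orbT.
    rewrite -(restr_rel rr) ?(subsetP Zs z zZ) ?(subsetP Ws w wW) //.
    by case/imsetP: zZ wW => b _ -> /imsetP[c _ ->]; rewrite sE.
  - move=> z z' zZ z'Z; rewrite -(restr_rel rr) ?(subsetP Zs) //.
    by apply: achL; rewrite in_setU ?zZ ?z'Z orbT.
  - by case.
  case=> n [nW n0 ->]; rewrite cZ f2 // n0.
  have xW : x \notin W by apply/imsetP=> -[].
  by rewrite cardsU1 xW cW in nW *.
move=> r /extP[pr rs rr rA rB].
have sr (u v : Y) : ((Some (Some u), Some (Some v)) \in r) = (u == v) || lt u v.
  by rewrite -(restr_rel rr) ?suppY // sE.
have Br : B \subset supp r by rewrite rs (subset_trans Bs) ?subsetUr.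
have Ar : A \subset supp r by rewrite rs (subset_trans As) ?subsetUr.
have w0 : pw (Ordinal m_gt0) \in B :|: W by rewrite in_setU imset_f ?orbT.
have aw0 := rB _ w0.
have za : (pz true, a) \in r by apply: rA; apply: imset_f.
have -> : p.+1 = #|a |: A|.
  by rewrite cardsU1 cA (_ : a \notin A) //; apply/imsetP=> -[].
rewrite -cB; apply: (extsum_antichain VP pr) => //.
- by rewrite rs in_setU1.
- by rewrite subUset Ar andbT sub1set rs setU11.
- move=> u v /setU1P[->|/imsetP[b _ ->]] /setU1P[->|/imsetP[c _ ->]] //.
  + by move/(preo_trans pr za); rewrite sr.
  + by move=> /(preo_trans pr)/(_ aw0); rewrite sr.
  + by rewrite sr orbF => /eqP/some_some_eq.
- by move=> u v /imsetP[b _ ->] /imsetP[c _ ->]; rewrite sr orbF => /eqP/some_some_eq.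
- move=> u v /setU1P[->|/imsetP[b _ ->]] /imsetP[c _ ->]; last by rewrite sr.
  by apply: rB; rewrite in_setU imset_f.
- move=> u v /setU1P[->|/imsetP[b _ ->]] /imsetP[c _ ->]; last by rewrite sr.
  by apply/negP=> /(preo_trans pr)/(_ aw0); rewrite sr.
Qed.

End Insertion.

(** * Duality, and determination by the small values *)

Section Opposite.
Variable X : finType.
Implicit Types (r : {set X * X}) (A B D : {set X}) (x y : X).

Definition opp r : {set X * X} := [set u | (u.2, u.1) \in r].

Lemma oppE r x y : ((x, y) \in opp r) = ((y, x) \in r).
Proof. by rewrite inE. Qed.

Lemma oppK : involutive opp.
Proof. by move=> r; apply/setP=> -[x y]; rewrite !oppE. Qed.

Lemma supp_opp r : supp (opp r) = supp r.
Proof. by apply/setP=> x; rewrite !inE. Qed.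

Lemma opp_preo r : preo r -> preo (opp r).
Proof.
move=> pr; apply/preoP; split=> [x y|y x z]; rewrite !oppE ?supp_opp.
  by case/(preo_supp pr).
by move=> yx zy; apply: preo_trans pr zy yx.
Qed.

Lemma restr_opp r D : restr (opp r) D = opp (restr r D).
Proof.
by apply/setP=> -[x y]; rewrite restrE !oppE restrE [(x \in D) && _]andbC.
Qed.

Lemma eqv_opp r x y : eqv (opp r) x y = eqv r x y.
Proof. by rewrite /eqv !oppE andbC. Qed.

Lemma amalgams_opp r1 r2 r :
  (opp r \in amalgams (opp r1) (opp r2)) = (r \in amalgams r1 r2).
Proof.
rewrite !inE !supp_opp !restr_opp !(inj_eq (inv_inj oppK)).
by congr (_ && _); apply/idP/idP=> /opp_preo; rewrite ?oppK.
Qed.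

Lemma jrel_opp x A B : x \notin A :|: B -> [disjoint A & B] ->
  opp (jrel x A B) = jrel x B A.
Proof.
rewrite in_setU negb_or => /andP[/negPf xA /negPf xB] /pred0P dAB.
apply/setP=> -[u v]; rewrite oppE [LHS]inE [RHS]inE /= [A :|: B]setUC.
rewrite [v == u]eq_sym andbCA.
have [us|//] := boolP (u \in x |: (B :|: A)).
have [vs|//] := boolP (v \in x |: (B :|: A)); rewrite /=.
have [->|uv] //= := eqVneq u v; rewrite /jrank.
have := dAB u; have := dAB v; rewrite /=.
have [->|ux] := eqVneq u x; have [->|vx] := eqVneq v x; rewrite ?xA ?xB //;
  move: us vs; rewrite !in_setU1 !in_setU ?(negPf ux) ?(negPf vx) /=;
  by case: (u \in A); case: (u \in B); case: (v \in A); case: (v \in B).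
Qed.

End Opposite.

Section Duality.
Variables (k : fieldType) (V : valuation k) (N : nat -> nat -> k).
Hypothesis VP : is_valuation V N.

(** Reversing all preorders exchanges the two arguments of [N]. *)
Lemma valuation_opp :
  is_valuation (fun X r D => V (opp r) D : k) (fun p q => N q p).
Proof.
split=> [X r D pr De|X r C D pr CD|X r1 r2 pr1 pr2 C r12|X x A B xAB dAB].
- apply: (v_equiv VP); first exact: opp_preo.
  by move=> e; rewrite supp_opp => /De[d dD ed]; exists d; rewrite ?eqv_opp.
- by rewrite (v_mul VP (opp_preo pr) CD) restr_opp.
- have := v_amalg VP (opp_preo pr1) (opp_preo pr2).
  rewrite /= !supp_opp -/C !restr_opp r12 => -> //.
  rewrite (reindex_inj (inv_inj (@oppK X))) /=.
  by apply: eq_bigl => r; rewrite amalgams_opp.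
- by rewrite jrel_opp // setUC (v_jrel VP) 1?setUC // disjoint_sym.
Qed.

Lemma fval_opp p q : fval (fun p q => N q p) p q = fval N q p.
Proof. by rewrite /fval addrAC. Qed.

Lemma fval_insert_dual p q m : (0 < m)%N ->
  (forall n, (0 < n <= m.+1)%N -> fval N n 2 = 1) ->
  fval N p q.+2 = fval N (p + m) 2 * fval N p q.+1.
Proof.
move=> m0 f2; rewrite -!(fval_opp _ p) -!(fval_opp 2).
by apply: (fval_insert valuation_opp q p m0) => n /f2; rewrite fval_opp.
Qed.

Notation f := (fval N).

(** By [fval_insert] and its dual with [m = 1], first the values [f p 1] and
    [f 1 q], then [f 2 q] and [f p 2], for positive [p] and [q], propagate from
    the small ones. Once the
    latter are all 1, the case [m = 2] makes [f p q] independent of [p > 0], for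
    every [q] including 0, and dually. *)
Lemma fval_bits (K : bool -> bool -> k) : K true true = 1 ->
  (forall p q, (p <= 2)%N -> (q <= 2)%N -> f p q = K (0 < p)%N (0 < q)%N) ->
  forall p q, f p q = K (0 < p)%N (0 < q)%N.
Proof.
move=> K1 fK.
have fp1 p : f p.+1 1 = 1.
  elim: p => [|p IHp]; first by rewrite fK.
  rewrite (fval_insert VP p 1 (ltn0Sn 0)) ?IHp ?fK ?mulr1 //.
  by case=> [|[|[]]] // _; rewrite fK.
have f1q q : f 1 q.+1 = 1.
  elim: q => [|q IHq]; first by rewrite fK.
  rewrite (fval_insert_dual 1 q (ltn0Sn 0)) ?IHq ?fK ?mulr1 //.
  by case=> [|[|[]]] // _; rewrite fK.
have f2q q : f 2 q.+1 = 1.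
  elim: q => [|q <-]; first by rewrite fK.
  rewrite (fval_insert VP 0 q.+1 (ltn0Sn 0)) ?f1q ?mulr1 ?addn1 //.
  by case=> [|[|[]]] // _; rewrite fK.
have fp2 p : f p.+1 2 = 1.
  elim: p => [|p <-]; first by rewrite fK.
  rewrite (fval_insert_dual p.+1 0 (ltn0Sn 0)) ?fp1 ?mulr1 ?addn1 //.
  by case=> [|[|[]]] // _; rewrite fK.
have fp p q : f p.+1 q = f 1 q.
  elim: p => // p <-; rewrite (fval_insert VP p q (ltn0Sn 1)) ?addn2 ?f2q ?mul1r //.
  by case=> [|n] // _; rewrite f2q.
have fq p q : f p q.+1 = f p 1.
  elim: q => // q <-; rewrite (fval_insert_dual p q (ltn0Sn 1)) ?addn2 ?fp2 ?mul1r //.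
  by case=> [|n] // _; rewrite fp2.
case=> [|p] [|q]; rewrite ?fp ?fq; exact: fK.
Qed.

End Duality.

(** * Measures and degree functions at the posets J p q *)

(** The entry of index [(p, q)] of the matrix of [nu], for all [p] and [q]. *)
Definition starval (k : fieldType) (nu : emb_rule k) (p q : nat) : k :=
  nu (remove (star p q)) (J p q) (remove_incl (star p q)).

Lemma J_leE p q (u v : J p q) :
  (u <= v)%O = (u == v) || (J_rank u < J_rank v)%N.
Proof. exact: J_connectE. Qed.

Lemma val_jrel (k : fieldType) (nu : emb_rule k) (X : finType) (x : X)
    (A B : {set X}) : is_compositional nu -> x \notin A :|: B ->
  [disjoint A & B] ->
  val_rule nu (jrel x A B) (A :|: B) = starval nu #|A| #|B|.
Proof.
move=> nuM xAB /pred0P dAB.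
pose sg (u : J #|A| #|B|) : X := match u with
  | None => x | Some (inl i) => enum_val i | Some (inr j) => enum_val j end.
have sgs u : sg u \in x |: (A :|: B).
  case: u => [[i|j]|]; rewrite ?setU11 // in_setU1 in_setU enum_valP ?orbT //.
have sgr u : jrank x B (sg u) = J_rank u.
  rewrite /jrank; case: u => [[i|j]|] /=; last first.
  - by move: xAB; rewrite in_setU negb_or eqxx => /andP[_ /negPf ->].
  - by rewrite enum_valP.
  have iA := enum_valP i; move: (dAB (enum_val i)); rewrite /= iA /= => ->.
  by case: eqP => // e; move: xAB; rewrite -e in_setU iA.
have sgI : injective sg.
  move=> u v e; have := sgr u; rewrite e sgr.
  move: u v e => [[i|i]|] [[j|j]|] //= /enum_val_inj -> //.
have sgE u v : ((sg u, sg v) \in jrel x A B) = (u <= v)%O.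
  by rewrite inE /= !sgs !sgr J_leE (inj_eq sgI).
have pj := jrel_preo x A B.
have eqvx y : y \in x |: (A :|: B) -> eqv (jrel x A B) y y.
  by rewrite /eqv -supp_jrel => /supp_refl ->.
have sg_surj e : e \in x |: (A :|: B) -> exists u, sg u = e.
  case/setU1P=> [->|]; first by exists None.
  case/setUP=> [eA|eB]; [exists (Some (inl (enum_rank_in eA e)))
                        |exists (Some (inr (enum_rank_in eB e)))];
  by rewrite /= enum_rankK_in.
apply: (val_model nuM pj); exists sg, (fun u => sg (val u)); split.
- by split=> // e; rewrite supp_jrel => es; have [u <-] := sg_surj e es;
     exists u; apply: eqvx.
- have valAB (u : remove (star #|A| #|B|)) : sg (val u) \in A :|: B.
    case: u => [[[i|j]|] //=]; by rewrite in_setU enum_valP ?orbT.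
  split=> [u v|e]; first by rewrite restrE sgE !valAB !andbT.
  rewrite supp_restr supp_jrel => /setIP[es eAB].
  have [u ue] := sg_surj e es.
  have us : u != star #|A| #|B|.
    by apply: contraNneq xAB => e'; rewrite -ue e' in eAB.
  exists (Sub u us); rewrite /eqv !restrE /= ue eAB.
  by have := eqvx e es; rewrite /eqv => /andP[-> _].
- by move=> u; rewrite ffunE; apply: eqvx.
Qed.

Lemma measure_valuation (k : fieldType) (nu : emb_rule k) : is_measure nu ->
  is_valuation (fun X => @val_rule k nu X) (starval nu).
Proof.
move=> nuP; have nuM := measure_mult nuP; split.
- by move=> X r D; apply: val_equiv.
- by move=> X r C D; apply: val_mul.
- by move=> X r1 r2 pr1 pr2 C; apply: val_amalg.
- by move=> X x A B; apply: val_jrel.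
Qed.

Section Degree.
Variables (k : fieldType) (kap : emb_rule k).
Hypothesis kapP : is_degree kap.
Let kapM := degree_mult kapP.

(** Adjoining [x] is a push-out of the inclusion into [J p q] as soon as the
    [al i] generate the points below [x], and the [be j] those above. The [al i]
    may coincide, and [x] may be equivalent to another point: both freedoms
    are used below, the first to vary [p], the second to collapse a chain. *)
Lemma degree_val_gen (X : finType) (r : {set X * X}) (x : X) (p q : nat)
    (al : 'I_p -> X) (be : 'I_q -> X) : preo r -> x \in supp r ->
  (forall i, al i != x) -> (forall j, be j != x) ->
  (forall i, (al i, x) \in r) -> (forall j, (x, be j) \in r) ->
  (forall y, y != x -> (y, x) \in r -> exists i, (y, al i) \in r) ->
  (forall y, y != x -> (x, y) \in r -> exists j, (be j, y) \in r) ->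
  val_rule kap r (supp r :\ x) = starval kap p q.
Proof.
move=> pr xs alx bex alr ber algen begen.
set D := supp r :\ x.
have [Q [s sr]] := rep_exists pr.
have [P [t tr]] := rep_exists (restr_preo D pr).
have [a aE] := rep_map pr tr sr.
have tD y : t y \in D /\ t y \in supp r.
  have := rep_supp y tr; rewrite supp_restr => /setIP[]; by split.
have tle y y' : (y <= y')%O = ((t y, t y') \in r).
  by rewrite -tr.1 restrE (tD y).1 (tD y').1 !andbT.
rewrite (@val_model _ _ kapM _ r D _ _ a) //; last by exists s, t.
pose sg (u : J p q) : X := match u with
  | None => x | Some (inl i) => al i | Some (inr j) => be j end.
have sgs u : sg u \in supp r.
  case: u => [[i|j]|] //=; [exact: (preo_supp pr (alr i)).1|].
  exact: (preo_supp pr (ber j)).2.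
have sgM u v : (u <= v)%O -> (sg u, sg v) \in r.
  rewrite J_leE => /orP[/eqP->|]; first by rewrite supp_refl.
  case: u v => [[i|j]|] [[i'|j']|] //= _.
  exact: preo_trans pr (alr i) (ber j').
have /fin_all_exists[b bE] (u : remove (star p q)) :
    exists y, eqv r (sg (val u)) (t y).
  have uD : sg (val u) \in supp (restr r D).
    rewrite supp_restr in_setI sgs in_setD1 sgs andbT /=.
    by case: u => [[[i|j]|]] //=.
  by have [y /eqv_restr uy] := tr.2 _ uD; exists y.
have /fin_all_exists[b' b'E] (u : J p q) : exists z, eqv r (sg u) (s z).
  exact: sr.2.
have bM : monotone b.
  by move=> u v uv; rewrite tle -(eqv_rel pr (bE u) (bE v)) sgM.
apply: (degree_pushout kapP (b := b) (b' := b') bM); split.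
- by move=> y y' yy'; rewrite emb_le.
- by move=> u v uv; rewrite -sr.1 -(eqv_rel pr (b'E u) (b'E v)) sgM.
- move=> u; rewrite ffunE; apply: (rep_inj sr).
  apply: (eqv_trans pr _ (aE (b u))); apply: (eqv_trans pr _ (bE u)).
  by rewrite eqv_sym b'E.
move=> O f g fM gM fg.
have cover z : (exists y, a y = z) \/ z = b' None.
  have zs := rep_supp z sr; have [zx|zx] := eqVneq (s z) x.
    right; apply: (rep_inj sr); apply: (eqv_trans pr _ (b'E None)).
    by rewrite zx /eqv supp_refl.
  left; have zD : s z \in supp (restr r D).
    by rewrite supp_restr in_setI zs in_setD1 zx zs.
  have [y /eqv_restr zy] := tr.2 _ zD; exists y; apply: (rep_inj sr).
  by rewrite eqv_sym; apply: eqv_trans pr zy (aE y).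
have inl_neq i : Some (inl i) != star p q by [].
have inr_neq j : Some (inr j) != star p q by [].
have low y : (a y <= b' None)%O -> (f y <= g None)%O.
  rewrite -sr.1 -(eqv_rel pr (aE y) (b'E None)) => /algen[].
    by have := (tD y).1; rewrite in_setD1 => /andP[].
  move=> i yi; pose u : remove (star p q) := Sub (Some (inl i)) (inl_neq i).
  apply: (@le_trans _ _ (f (b u))).
    apply: fM; rewrite tle -(eqv_rel pr (_ : eqv r (t y) (t y)) (bE u)) //.
    by rewrite /eqv supp_refl // (tD y).2.
  by rewrite -fg ffunE; apply: gM; rewrite J_leE.
have up y : (b' None <= a y)%O -> (g None <= f y)%O.
  rewrite -sr.1 -(eqv_rel pr (b'E None) (aE y)) => /begen[].
    by have := (tD y).1; rewrite in_setD1 => /andP[].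
  move=> j jy; pose u : remove (star p q) := Sub (Some (inr j)) (inr_neq j).
  apply: (@le_trans _ _ (f (b u))).
    by rewrite -fg ffunE; apply: gM; rewrite J_leE.
  apply: fM; rewrite tle -(eqv_rel pr (bE u) (_ : eqv r (t y) (t y))) //.
  by rewrite /eqv supp_refl // (tD y).2.
have /fin_all_exists[h hE] (z : Q) : exists w,
    (forall y, a y = z -> w = f y) /\ (z = b' None -> w = g None).
  have [[y yz]|zb] := cover z.
    exists (f y); split=> [y' y'z|zb].
      by rewrite (emb_inj (etrans yz (esym y'z))).
    by apply/le_anti; rewrite low ?up // yz zb.
  exists (g None); split=> // y yz.
  by apply/le_anti; rewrite low ?up // yz zb.
have ha y : h (a y) = f y by have [/(_ y erefl)] := hE (a y).
have hb : h (b' None) = g None by have [_ /(_ erefl)] := hE (b' None).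
have ab (u : remove (star p q)) : b' (val u) = a (b u).
  apply: (rep_inj sr).
  apply: (eqv_trans pr _ (aE (b u))); apply: (eqv_trans pr _ (bE u)).
  by rewrite eqv_sym b'E.
exists h; split=> //.
- move=> z z'; have [[y <-]|->] := cover z; have [[y' <-]|->] := cover z';
    rewrite ?ha ?hb //.
  + by rewrite emb_le => /fM.
  + exact: low.
  + exact: up.
- move=> u; have [->|us] := eqVneq u (star p q); first exact: hb.
  by have := ab (Sub u us); rewrite /= => ->; rewrite ha -fg ffunE.
- move=> h' _ h'a h'b z; have [[y <-]|->] := cover z; first by rewrite h'a ha.
  by rewrite h'b hb.
Qed.

(** The value depends only on whether points lie below, and above, the one
    adjoined; booleans are read as numbers. *)
Definition starbit (b c : bool) : k := starval kap b c.

(** The extension of a chain by its middle point, with one bound or the other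
    possibly missing, is generated by any positive number of copies of the
    bounds. *)
Lemma starval_bits p q : starval kap p q = starbit (0 < p)%N (0 < q)%N.
Proof.
pose A : {set option bool} := if (0 < p)%N then [set Some true] else set0.
pose B : {set option bool} := if (0 < q)%N then [set Some false] else set0.
pose r := jrel None A B; have pr : preo r := jrel_preo _ _ _.
have rx : None \in supp r by rewrite supp_jrel setU11.
have inA y : (y \in A) = (0 < p)%N && (y == Some true).
  by rewrite /A; case: (0 < p)%N; rewrite inE.
have inB y : (y \in B) = (0 < q)%N && (y == Some false).
  by rewrite /B; case: (0 < q)%N; rewrite inE.
have rE y z : ((y, z) \in r) = [&& y \in None |: (A :|: B),
    z \in None |: (A :|: B) & (y == z) || (jrank None B y < jrank None B z)%N].
  by rewrite inE.
have main p' q' : (0 < p')%N = (0 < p)%N -> (0 < q')%N = (0 < q)%N ->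
    val_rule kap r (supp r :\ None) = starval kap p' q'.
  move=> pp qq; apply: (degree_val_gen (al := fun=> Some true)
    (be := fun=> Some false) pr rx) => //.
  - move=> i; have p0 : (0 < p)%N by rewrite -pp (leq_ltn_trans _ (ltn_ord i)).
    by rewrite rE !in_setU1 !in_setU /jrank !inA !inB p0 /= !andbF.
  - move=> i; have q0 : (0 < q)%N by rewrite -qq (leq_ltn_trans _ (ltn_ord i)).
    by rewrite rE !in_setU1 !in_setU /jrank !inA !inB q0 /= !andbF orbT.
  - move=> y yN yx; case: y yN yx => [[]|] // _.
      rewrite rE !in_setU1 !in_setU !inA !inB /= !andbF orbF andbT -pp => /andP[p0 _].
      exists (Ordinal p0); rewrite rE eqxx !andbT andbb !in_setU1 !in_setU !inA.
      by rewrite -pp p0.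
    by rewrite rE !in_setU1 !in_setU /jrank !inA !inB /= !andbF; case: (0 < q)%N.
  - move=> y yN yx; case: y yN yx => [[]|] // _.
      by rewrite rE !in_setU1 !in_setU /jrank !inA !inB /= !andbF.
    rewrite rE !in_setU1 !in_setU !inA !inB /= !andbF /= andbT -qq => /andP[q0 _].
    exists (Ordinal q0); rewrite rE eqxx !andbT andbb !in_setU1 !in_setU !inB.
    by rewrite -qq q0 !orbT.
by rewrite /starbit -(main p q) // (main (0 < p)%N (0 < q)%N) ?lt0b.
Qed.

(** Take for [x] a point equivalent to another one: nothing is added. *)
Lemma starbit11 : starbit true true = 1.
Proof.
have pr : preo [set: bool * bool] by apply/preoP; split=> *; rewrite !inE.
rewrite -[LHS](@degree_val_gen _ [set: bool * bool] true 1 1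
  (fun=> false) (fun=> false) pr) //; rewrite ?inE //.
- apply: (val_equiv kapM pr) => e _; exists false; first by rewrite !inE.
  by rewrite /eqv !inE.
- by move=> y _ _; exists ord0; rewrite inE.
- by move=> y _ _; exists ord0; rewrite inE.
Qed.

Lemma degree_val (X : finType) (r : {set X * X}) (x : X) : preo r ->
  x \in supp r ->
  val_rule kap r (supp r :\ x) = starbit [exists y, (y != x) && ((y, x) \in r)]
                                         [exists y, (y != x) && ((x, y) \in r)].
Proof.
move=> pr xs; pose L := [set y | (y != x) && ((y, x) \in r)].
pose U := [set y | (y != x) && ((x, y) \in r)].
have bitE (S : pred X) : (0 < #|[set y | S y]|)%N = [exists y, S y].
  by apply/card_gt0P/existsP=> -[y]; rewrite ?inE => yS; exists y; rewrite ?inE.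
have LP (i : 'I_#|L|) : (enum_val i != x) && ((enum_val i, x) \in r).
  by have := enum_valP i; rewrite inE.
have UP (i : 'I_#|U|) : (enum_val i != x) && ((x, enum_val i) \in r).
  by have := enum_valP i; rewrite inE.
rewrite (@degree_val_gen _ r x #|L| #|U| enum_val enum_val pr xs).
- by rewrite starval_bits !bitE.
- by move=> i; case/andP: (LP i).
- by move=> i; case/andP: (UP i).
- by move=> i; case/andP: (LP i).
- by move=> i; case/andP: (UP i).
- move=> y yx yr; have yL : y \in L by rewrite inE yx.
  exists (enum_rank_in yL y); rewrite enum_rankK_in //.
  by apply: supp_refl; case: (preo_supp pr yr).
- move=> y yx yr; have yU : y \in U by rewrite inE yx.
  exists (enum_rank_in yU y); rewrite enum_rankK_in //.
  by apply: supp_refl; case: (preo_supp pr yr).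
Qed.

End Degree.

(** * Relations between the values of a degree function *)

Section DegreeRelations.
Variables (k : fieldType) (kap : emb_rule k).
Hypothesis kapP : is_degree kap.
Let kapM := degree_mult kapP.
Notation K := (starbit kap).

(** Inserting [x] and [y] in a poset reduced to [z], in both orders. *)
Lemma starbit_square (X : finType) (r : {set X * X}) (x y z : X) :
  preo r -> supp r = x |: (y |: [set z]) -> x != y -> x != z -> y != z ->
  K ((z, x) \in r) ((x, z) \in r)
    * K (((z, y) \in r) || ((x, y) \in r)) (((y, z) \in r) || ((y, x) \in r))
  = K ((z, y) \in r) ((y, z) \in r)
    * K (((z, x) \in r) || ((y, x) \in r)) (((x, z) \in r) || ((x, y) \in r)).
Proof.
move=> pr rs xy xz yz.
have half u v : supp r = u |: (v |: [set z]) -> u != v -> u != z -> v != z ->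
  val_rule kap r [set z] = K ((z, u) \in r) ((u, z) \in r)
    * K (((z, v) \in r) || ((u, v) \in r)) (((v, z) \in r) || ((v, u) \in r)).
  move=> {}rs uv uz vz.
  have sD : supp r :\ v = [set u; z].
    apply/setP=> w; rewrite rs !inE; have [->|] //= := eqVneq w v.
    by rewrite eq_sym (negPf uv) (negPf vz).
  have sR : supp (restr r (supp r :\ v)) = [set u; z].
    by rewrite supp_restr (setIidPr _) ?subD1set.
  have sz : [set z] = supp (restr r (supp r :\ v)) :\ u.
    apply/setP=> w; rewrite sR !inE.
    by have [->|] //= := eqVneq w u; rewrite (negPf uz).
  have zs : [set z] \subset supp r :\ v by rewrite sD sub1set !inE eqxx orbT.
  have prR := restr_preo (supp r :\ v) pr.
  rewrite (val_mul kapM pr zs) {1}sz (degree_val kapP prR); last first.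
    by rewrite sR !inE eqxx.
  rewrite (degree_val kapP pr); last by rewrite rs !inE eqxx orbT.
  have memr w1 w2 : (w1, w2) \in r ->
      [|| w1 == u, w1 == v | w1 == z] /\ [|| w2 == u, w2 == v | w2 == z].
    by case/(preo_supp pr); rewrite rs !inE.
  congr (K _ _ * K _ _).
  - apply/existsP/idP => [[w]|zu]; last first.
      by exists z; rewrite eq_sym uz restrE zu sD !inE !eqxx orbT.
    rewrite restrE sD => /and4P[wu wr]; rewrite !inE (negPf wu) /= => /eqP <- //.
  - apply/existsP/idP => [[w]|zu]; last first.
      by exists z; rewrite eq_sym uz restrE zu sD !inE !eqxx orbT.
    rewrite restrE sD => /and4P[wu wr _]; rewrite !inE (negPf wu) /= => /eqP <- //.
  - apply/existsP/orP => [[w /andP[wv wr]]|[zv|zv]].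
    + by have [/or3P[]/eqP E _] := memr _ _ wr; 
      move: wv wr; rewrite E ?eqxx //; [right|left].
    + by exists z; rewrite eq_sym vz.
    + by exists u; rewrite uv.
  - apply/existsP/orP => [[w /andP[wv wr]]|[zv|zv]].
    + by have [_ /or3P[]/eqP E] := memr _ _ wr; 
      move: wv wr; rewrite E ?eqxx //; [right|left].
    + by exists z; rewrite eq_sym vz.
    + by exists u; rewrite uv.
rewrite -half // -(half y x) ?rs 1?setUCA // eq_sym //.
Qed.

(** Instances of [starbit_square]: the chains [z < x < y] and [y < x < z], then
    [y] above, and below, two incomparable points. *)
Lemma starbit_relations (s := K false false) (u := K true false)
    (v := K false true) :
  [/\ u * u = u, v * v = v, s * u = u * v & s * v = v * u].
Proof.
pose z : option bool := Some true; pose o : option bool := None.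
pose y : option bool := Some false.
have setE : [set: option bool] = o |: (y |: [set z]).
  by apply/setP=> -[[]|]; rewrite !inE.
have K11 := starbit11 kapP.
have jE w (A B : {set option bool}) c d : ((c, d) \in jrel w A B)
    = [&& c \in w |: (A :|: B), d \in w |: (A :|: B)
        & (c == d) || (jrank w B c < jrank w B d)%N] by rewrite inE.
have sq w (A B : {set option bool}) : w |: (A :|: B) = setT ->
    let r := jrel w A B in
  K ((z, o) \in r) ((o, z) \in r)
    * K (((z, y) \in r) || ((o, y) \in r)) (((y, z) \in r) || ((y, o) \in r))
  = K ((z, y) \in r) ((y, z) \in r)
    * K (((z, o) \in r) || ((y, o) \in r)) (((o, z) \in r) || ((o, y) \in r)).
  move=> wAB r; apply: starbit_square => //; first exact: jrel_preo.
  by rewrite supp_jrel wAB setE.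
split.
- have := sq o [set z] [set y]; rewrite /= !jE /jrank.
  rewrite (_ : _ |: _ = setT); last by apply/setP=> -[[]|]; rewrite !inE.
  by rewrite !inE /= K11 mulr1; apply.
- have := sq o [set y] [set z]; rewrite /= !jE /jrank.
  rewrite (_ : _ |: _ = setT); last by apply/setP=> -[[]|]; rewrite !inE.
  by rewrite !inE /= K11 mulr1; apply.
- have := sq y [set z; o] set0; rewrite /= !jE /jrank.
  rewrite (_ : _ |: _ = setT); last by apply/setP=> -[[]|]; rewrite !inE.
  by rewrite !inE /=; apply.
- have := sq y set0 [set z; o]; rewrite /= !jE /jrank.
  rewrite (_ : _ |: _ = setT); last by apply/setP=> -[[]|]; rewrite !inE.
  by rewrite !inE /=; apply.
Qed.

End DegreeRelations.

(** * Push-outs and explicit degree functions *)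

Definition upset (Q : poset) (U : {set Q}) : Prop :=
  forall x y : Q, (x <= y)%O -> x \in U -> y \in U.

Section Pushout.
Variables (P Q P' Q' : poset) (a : embedding P Q) (b : P -> P').
Variables (a' : embedding P' Q') (b' : Q -> Q').
Hypothesis po : is_pushout a b a' b'.

Let comm x : b' (a x) = a' (b x). Proof. by case: po. Qed.
Let b'M : monotone b'. Proof. by case: po. Qed.

(** Up-sets are the monotone maps to the two-element chain, so they satisfy the
    universal property of the push-out; no other test object is needed. *)
Lemma pushout_upset (U : {set Q}) (U' : {set P'}) : upset U -> upset U' ->
  (forall x, (a x \in U) = (b x \in U')) ->
  exists W : {set Q'}, [/\ upset W, forall y, (a' y \in W) = (y \in U'),
    forall y, (b' y \in W) = (y \in U)
    & forall W' : {set Q'}, upset W' -> (forall y, (a' y \in W') = (y \in U')) ->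
      (forall y, (b' y \in W') = (y \in U)) -> W' = W].
Proof.
move=> Uup U'up UU'; have [_ _ _ univ] := po.
pose c (i : bool) : J 0 1 := if i then Some (inr ord0) else None.
have cle i j : (c i <= c j)%O = (i ==> j) by rewrite J_leE; case: i; case: j.
have cE (u : J 0 1) : u = c (u != None).
  by case: u => [[[]|i]|] //=; rewrite [i]ord1.
have cM (T : poset) (S : {set T}) : upset S -> monotone (fun x => c (x \in S)).
  by move=> Sup x y xy; rewrite cle; apply/implyP; apply: Sup.
have [x|h [hM ha hb hU]] := univ _ _ _ (cM _ _ U'up) (cM _ _ Uup).
  by rewrite UU'.
exists [set z | h z != None]; split.
- move=> x y xy; rewrite !inE; apply/implyP; rewrite -cle -(cE (h x)) -(cE (h y)).
  exact: hM.
- by move=> y; rewrite inE ha; case: (y \in U').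
- by move=> y; rewrite inE hb; case: (y \in U).
- move=> W' W'up W'a W'b; apply/setP=> z; rewrite inE.
  rewrite -(hU _ (cM _ _ W'up)); first by case: (z \in W').
    by move=> y; rewrite W'a.
  by move=> y; rewrite W'b.
Qed.

(** Otherwise the up-sets of the elements above [z] and of those strictly above
    [z] would have the same traces on [P'] and [Q], although they differ. *)
Lemma pushout_cover z : (exists y, a' y = z) \/ (exists y, b' y = z).
Proof.
have [/existsP[y /eqP]|na] := boolP [exists y, a' y == z]; first by left; exists y.
have [/existsP[y /eqP]|nb] := boolP [exists y, b' y == z]; first by right; exists y.
pose W1 := [set w : Q' | (z <= w)%O]; pose W2 := [set w : Q' | (z < w)%O].
have W1up : upset W1 by move=> x y xy; rewrite !inE => /le_trans; apply.
have W2up : upset W2 by move=> x y xy; rewrite !inE => /lt_le_trans; apply.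
have W12 w : w != z -> (w \in W1) = (w \in W2).
  by move=> wz; rewrite !inE lt_neqAle eq_sym wz.
have az y : a' y != z by move/existsPn: na.
have bz y : b' y != z by move/existsPn: nb.
have [||x|W [_ _ _ WU]] :=
    @pushout_upset (b' @^-1: W1) (a' @^-1: W1).
- by move=> x y xy; rewrite !inE => /le_trans; apply; apply: b'M.
- by move=> x y xy; rewrite !inE => /le_trans; apply; rewrite emb_le.
- by rewrite !inE comm.
have E1 : W1 = W by apply: WU => // y; rewrite [RHS]inE.
have E2 : W2 = W by apply: WU => // y; rewrite [RHS]inE W12.
by have := W12; have /setP/(_ z) := etrans E1 (esym E2); rewrite !inE lexx ltxx.
Qed.

End Pushout.

(** The boolean [true] selects the order and [false] its opposite, so that
    statements about lower and upper bounds are proved together. *)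
Definition dle (d : bool) (P : poset) (x y : P) : bool :=
  if d then (x <= y)%O else (y <= x)%O.

Definition reach (d : bool) (P Q : poset) (a : P -> Q) (q : Q) : bool :=
  [exists p, dle d (a p) q].

Lemma dle_refl d (P : poset) (x : P) : dle d x x.
Proof. by rewrite /dle; case: d. Qed.

Lemma dle_trans d (P : poset) (y x z : P) : dle d x y -> dle d y z -> dle d x z.
Proof. by rewrite /dle; case: d => [|xy yz]; [apply: le_trans|apply: le_trans xy]. Qed.

Lemma dle_emb d (P Q : poset) (a : embedding P Q) x y :
  dle d (a x) (a y) = dle d x y.
Proof. by rewrite /dle; case: d; rewrite emb_le. Qed.

Lemma reach_im d (P Q : poset) (a : P -> Q) p : reach d a (a p).
Proof. by apply/existsP; exists p; apply: dle_refl. Qed.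

Lemma reach_dle d (P Q : poset) (a : P -> Q) q q' :
  reach d a q -> dle d q q' -> reach d a q'.
Proof.
by move=> /existsP[p pq] qq'; apply/existsP; exists p; apply: dle_trans qq'.
Qed.

Lemma reach_comp d (P Q R : poset) (a : embedding P Q) (c : embedding Q R) r :
  reach d (emb_comp c a) r -> reach d c r.
Proof. by case/existsP=> p; rewrite ffunE => pr; apply/existsP; exists (a p). Qed.

Lemma reach_comp_im d (P Q R : poset) (a : embedding P Q) (c : embedding Q R) q :
  reach d (emb_comp c a) (c q) = reach d a q.
Proof. by apply: eq_existsb => p; rewrite ffunE dle_emb. Qed.

Lemma reach_trans d (P Q R : poset) (a : embedding P Q) (c : embedding Q R) q r :
  reach d a q -> dle d (c q) r -> reach d (emb_comp c a) r.
Proof. by rewrite -(reach_comp_im d a c) => /reach_dle; apply. Qed.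

(** The elements above an element of [P] form an up-set of [Q], to be glued with
    all of [P']; those not below one form an up-set glued with the empty set. *)
Lemma pushout_reach d (P Q P' Q' : poset) (a : embedding P Q) (b : P -> P')
    (a' : embedding P' Q') (b' : Q -> Q') : is_pushout a b a' b' ->
  forall q, reach d a' (b' q) = reach d a q.
Proof.
move=> po q; have [a'M b'M comm _] := po; apply/idP/idP; last first.
  case/existsP=> p pq; apply/existsP; exists (b p); rewrite -comm.
  by move: pq; rewrite /dle; case: d; apply: b'M.
case/existsP=> p' p'q; case: d p'q => /= p'q.
  have [|||W [Wup Wa Wb _]] :=
      @pushout_upset _ _ _ _ _ _ _ _ po [set q | reach true a q] setT.
  - by move=> x y xy; rewrite !inE => /reach_dle; apply.
  - by move=> x y xy; rewrite !inE.
  - by move=> x; rewrite !inE reach_im.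
  have := Wup _ _ p'q; rewrite Wb Wa !inE; exact.
have [|||W [Wup Wa Wb _]] :=
    @pushout_upset _ _ _ _ _ _ _ _ po [set q | ~~ reach false a q] set0.
- by move=> x y xy; rewrite !inE; apply: contra => /reach_dle; apply.
- by move=> x y xy; rewrite !inE.
- by move=> x; rewrite !inE reach_im.
have := Wup _ _ p'q; rewrite Wb Wa !inE => h.
by apply: contraT => /h.
Qed.

Section Degrees.
Variable k : fieldType.

Definition deg_one : emb_rule k := fun _ _ _ => 1.

Lemma deg_one_degree : is_degree deg_one.
Proof. by split=> // *; rewrite /deg_one mulr1. Qed.

Definition deg_reach (d : bool) : emb_rule k :=
  fun P Q a => [forall q, reach d a q]%:R.

Lemma natrb (b c : bool) : (b && c)%:R = b%:R * c%:R :> k.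
Proof. by case: b; case: c; rewrite ?mulr1 ?mulr0. Qed.

Lemma deg_reach_degree d : is_degree (deg_reach d).
Proof.
split=> [P Q a [c [_ cK]]|P Q R a c|P Q P' Q' a b a' b' bM po]; rewrite /deg_reach.
- rewrite (_ : [forall q, _] = true) //; apply/forallP=> q.
  by rewrite -(cK q) reach_im.
- rewrite -natrb; congr (_%:R); congr nat_of_bool.
  apply/forallP/andP => [h|[/forallP hc /forallP ha] r].
    split; apply/forallP; first by move=> r; apply: reach_comp (h r).
    by move=> q; have := h (c q); rewrite reach_comp_im.
  by have /existsP[q qr] := hc r; apply: reach_trans (ha q) qr.
- congr (_%:R); congr nat_of_bool; apply/forallP/forallP => h q.
    by rewrite -(pushout_reach d po) h.
  have [[y <-]|[y <-]] := pushout_cover po q; first exact: reach_im.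
  by rewrite (pushout_reach d po) h.
Qed.

(** A new isolated element. An element comparable to itself only lies above an
    element of the image exactly when it belongs to the image. *)
Definition loose (P Q : poset) (a : P -> Q) (q : Q) : bool :=
  ~~ reach true a q && [forall y, (q <= y)%O || (y <= q)%O ==> (y == q)].

Definition tame (P Q : poset) (a : P -> Q) : bool :=
  [forall q, loose a q || reach true a q && reach false a q].

Definition deg_loose (t : k) : emb_rule k :=
  fun P Q a => (tame a)%:R * t ^+ #|[set q | loose a q]|.

Definition isolated (Q : poset) (q : Q) :=
  forall y, (q <= y)%O || (y <= q)%O -> y = q.

Lemma looseP (P Q : poset) (a : P -> Q) q :
  reflect (~~ reach true a q /\ isolated q) (loose a q).
Proof.
apply: (iffP andP) => -[nq iq]; split=> //.
  by move=> y /(implyP (forallP iq y))/eqP.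
by apply/forallP=> y; apply/implyP=> /iq ->.
Qed.

Lemma tameP (P Q : poset) (a : P -> Q) :
  reflect (forall q, loose a q \/ reach true a q /\ reach false a q) (tame a).
Proof.
apply: (iffP forallP) => h q; first by case/orP: (h q) => [|/andP]; [left|right].
by apply/orP; case: (h q) => [|[-> ->]]; [left|right].
Qed.

Section Composition.
Variables (P Q R : poset) (a : embedding P Q) (c : embedding Q R).

Lemma isolated_emb q : isolated (c q) -> isolated q.
Proof.
by move=> h y yq; apply: (@emb_inj _ _ c); apply: h; rewrite !emb_le.
Qed.

(** In a tame extension a new element comparable to some old one lies between
    two old ones, so isolated old elements remain isolated. *)
Lemma tame_isolated q : tame c -> isolated q -> isolated (c q).
Proof.
move=> /tameP h iq y yq; case: (h y) => [/looseP[_ iy]|].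
  by apply/esym/iy; rewrite orbC.
case=> /existsP[q1 /= q1y] /existsP[q2 /= q2y]; case/orP: yq => yq.
  have e : q2 = q by apply: iq; rewrite -(emb_le c) (le_trans yq q2y).
  by apply/le_anti; rewrite yq andbT -e.
have e : q1 = q by apply: iq; rewrite -!(emb_le c) (le_trans q1y yq) orbT.
by apply/le_anti; rewrite yq /= -e.
Qed.

Lemma tame_comp : tame (emb_comp c a) = tame c && tame a.
Proof.
apply/tameP/andP => [h|[tc /tameP ta]]; first (split; apply/tameP).
- move=> r; case: (h r) => [/looseP[_ ir]|[r1 r2]]; last first.
    by right; split; [apply: reach_comp r1|apply: reach_comp r2].
  have [/existsP[q qr]|nr] := boolP (reach true c r).
    have -> : r = c q by apply/esym/ir; rewrite [X in _ || X]qr orbT.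
    by right; rewrite !reach_im.
  by left; apply/looseP.
- move=> q; case: (h (c q)) => [/looseP[nq iq]|]; rewrite ?reach_comp_im.
    left; apply/looseP; split; last exact: isolated_emb.
    by rewrite -(reach_comp_im true a c).
  by right.
move=> r; move/tameP: (tc) => /(_ r) [/looseP[nr ir]|[]].
  by left; apply/looseP; split=> //; apply: contra nr => /reach_comp.
move=> /existsP[q1 q1r] /existsP[q2 q2r].
have q12 : (q1 <= q2)%O by rewrite -(emb_le c); apply: le_trans q1r q2r.
have loose_case q : loose a q -> r = c q ->
    loose (emb_comp c a) r
    \/ reach true (emb_comp c a) r /\ reach false (emb_comp c a) r.
  case/looseP=> nq iq ->; left; apply/looseP; rewrite reach_comp_im; split=> //.
  exact: tame_isolated.
case: (ta q1) => [l1|[lo1 up1]].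
  apply: (loose_case q1 l1); have [_ i1] := looseP _ _ l1.
  have e : q2 = q1 by apply: i1; rewrite q12.
  by apply/le_anti; rewrite [(c q1 <= r)%O]q1r andbT -e.
case: (ta q2) => [l2|[lo2 up2]].
  apply: (loose_case q2 l2); have [_ i2] := looseP _ _ l2.
  have e : q1 = q2 by apply: i2; rewrite q12 orbT.
  by apply/le_anti; rewrite [(r <= c q2)%O]q2r /= -e.
by right; split; [apply: reach_trans lo1 q1r|apply: reach_trans up2 q2r].
Qed.

Lemma loose_comp : tame c ->
  #|[set r | loose (emb_comp c a) r]|
  = (#|[set r | loose c r]| + #|[set q | loose a q]|)%N.
Proof.
move=> tc; rewrite -(card_imset [set q | loose a q] (@emb_inj _ _ c)).
rewrite -cardsUI (_ : _ :&: _ = set0) ?cards0 ?addn0; last first.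
  apply/setP=> r; rewrite !inE; apply/negP=> /andP[/andP[nr _] /imsetP[q _ e]].
  by move: nr; rewrite e reach_im.
apply: eq_card => r; rewrite in_setU in_set [r \in [set _ | loose c _]]in_set.
apply/idP/orP => [/looseP[nr ir]|[/looseP[nr ir]|/imsetP[q]]].
- have [/existsP[q qr]|nr'] := boolP (reach true c r); last by left; apply/looseP.
  have e : r = c q by apply/esym/ir; rewrite [X in _ || X]qr orbT.
  right; rewrite e; apply: imset_f; rewrite in_set; apply/looseP.
  rewrite e in nr ir; split; last exact: isolated_emb.
  by rewrite -(reach_comp_im true a c).
- by apply/looseP; split=> //; apply: contra nr => /reach_comp.
rewrite in_set => /looseP[nq iq] ->; apply/looseP; rewrite reach_comp_im.
by split=> //; apply: tame_isolated.
Qed.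

End Composition.

Section LoosePushout.
Variables (P Q P' Q' : poset) (a : embedding P Q) (b : P -> P').
Variables (a' : embedding P' Q') (b' : Q -> Q').
Hypothesis po : is_pushout a b a' b'.

Let b'M : monotone b'. Proof. by case: po. Qed.

(** Test on the up-set generated by [y] and the image of [a]. *)
Lemma pushout_separate q y : ~~ reach true a q -> ~~ (y <= q)%O -> b' y != b' q.
Proof.
move=> nq yq; pose U := [set w | reach true a w || (y <= w)%O].
have [|||W [Wup Wa Wb _]] := @pushout_upset _ _ _ _ _ _ _ _ po U setT.
- move=> u v uv; rewrite !inE => /orP[/reach_dle/(_ uv)->//|yu].
  by rewrite (le_trans yu uv) orbT.
- by move=> u v uv; rewrite !inE.
- by move=> u; rewrite !inE reach_im.
by apply/eqP=> e; have := Wb q; rewrite -e Wb !inE lexx orbT (negPf nq) (negPf yq).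
Qed.

(** The singleton of [q] and its complement are both up-sets, and extend to
    up-sets of the push-out. *)
Lemma pushout_isolated q : loose a q ->
  forall y : Q', (b' q <= y)%O || (y <= b' q)%O -> y = b' q.
Proof.
case/looseP=> nq iq z.
have up_q y : (q <= y)%O -> y = q by move=> h; apply: iq; rewrite h.
have dn_q y : (y <= q)%O -> y = q by move=> h; apply: iq; rewrite h orbT.
have naq p : a p != q by apply: contraNneq nq => <-; apply: reach_im.
have [|||W [Wup Wa Wb _]] := @pushout_upset _ _ _ _ _ _ _ _ po [set q] set0.
- by move=> u v uv; rewrite !inE => /eqP e; rewrite e in uv; rewrite (up_q _ uv).
- by move=> u v uv; rewrite !inE.
- by move=> u; rewrite !inE (negPf (naq u)).
have [|||W2 [W2up W2a W2b _]] := @pushout_upset _ _ _ _ _ _ _ _ po (~: [set q]) setT.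
- move=> u v uv; rewrite !inE; apply: contraNneq => e.
  by rewrite e in uv; rewrite (dn_q _ uv).
- by move=> u v uv; rewrite !inE.
- by move=> u; rewrite !inE naq.
case/orP=> zq.
  have := Wup _ _ zq; rewrite Wb !inE eqxx => /(_ isT).
  have [[y <-]|[y <-]] := pushout_cover po z; first by rewrite Wa inE.
  by rewrite Wb inE => /eqP ->.
have := W2up _ _ zq; rewrite W2b !inE eqxx.
have [[y <-]|[y <-]] := pushout_cover po z; first by rewrite W2a inE => /(_ isT).
by rewrite W2b !inE; have [->//|_ /(_ isT)] := eqVneq y q.
Qed.

Lemma pushout_loose q : loose a' (b' q) = loose a q.
Proof.
apply/idP/idP => [/looseP[nq iq]|lq]; apply/looseP.
  rewrite (pushout_reach _ po) in nq; split=> // y yq.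
  have e : b' y = b' q.
    by apply: iq; case/orP: yq => /b'M ->; rewrite ?orbT.
  apply/le_anti/andP; split; apply/negPn/negP => ny.
    by have := pushout_separate nq ny; rewrite e eqxx.
  case/orP: yq => yq; first by rewrite yq in ny.
  have nry : ~~ reach true a y by apply: contra nq => /reach_dle; apply.
  by have := pushout_separate nry ny; rewrite e eqxx.
split; last exact: pushout_isolated.
by rewrite (pushout_reach _ po); case/looseP: lq.
Qed.

Lemma pushout_card_loose : #|[set z | loose a' z]| = #|[set q | loose a q]|.
Proof.
have -> : [set z | loose a' z] = b' @: [set q | loose a q].
  apply/setP=> z; rewrite in_set; apply/idP/imsetP => [lz|[q]]; last first.
    by rewrite in_set => lq ->; rewrite pushout_loose.
  have [[y e]|[q e]] := pushout_cover po z.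
    by case/looseP: lz; rewrite -e reach_im.
  by exists q; rewrite // in_set -pushout_loose e.
apply: card_in_imset => q y; rewrite !in_set => lq ly e.
have [nq iq] := looseP _ _ lq.
apply/esym/iq/orP; right; apply/negPn/negP => yq.
by have := pushout_separate nq yq; rewrite e eqxx.
Qed.

Lemma pushout_tame : tame a' = tame a.
Proof.
apply/tameP/tameP => h q.
  by case: (h (b' q)); rewrite ?pushout_loose ?(pushout_reach _ po); [left|right].
have [[y <-]|[y <-]] := pushout_cover po q; first by right; rewrite !reach_im.
by rewrite pushout_loose !(pushout_reach _ po).
Qed.

End LoosePushout.

Lemma deg_loose_degree t : is_degree (deg_loose t).
Proof.
split=> [P Q a [c [_ cK]]|P Q R a c|P Q P' Q' a b a' b' bM po]; rewrite /deg_loose.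
- have im q : q = a (c q) by rewrite cK.
  rewrite (_ : tame a = true); last first.
    by apply/tameP=> q; right; rewrite (im q) !reach_im.
  rewrite (_ : [set q | _] = set0) ?cards0 ?mulr1 //.
  apply/setP=> q; rewrite !inE; apply/negP=> /looseP[].
  by rewrite (im q) reach_im.
- rewrite tame_comp natrb; case tc: (tame c); last by rewrite !mul0r.
  by rewrite loose_comp // exprD mulrACA.
- by rewrite (pushout_card_loose po) (pushout_tame po).
Qed.

End Degrees.

(** * From a degree function to the induced measure *)

Section StarValues.
Variable k : fieldType.

Lemma star_reach d p q : reach d (remove_incl (star p q)) None
  = (0 < (if d then p else q))%N.
Proof.
apply/existsP/idP => [[[[[i|j]|] //= h]]|].
- rewrite /dle ffunE !J_leE; case: d => //= _.
  exact: leq_ltn_trans (ltn_ord i).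
- rewrite /dle ffunE !J_leE; case: d => //= _.
  exact: leq_ltn_trans (ltn_ord j).
case: d => h.
- by exists (Sub (Some (inl (Ordinal h))) isT); rewrite /dle ffunE J_leE.
- by exists (Sub (Some (inr (Ordinal h))) isT); rewrite /dle ffunE J_leE.
Qed.

Lemma star_reach_im d p q (u : J p q) : u != None ->
  reach d (remove_incl (star p q)) u.
Proof.
move=> uN; have -> : u = remove_incl (star p q) (Sub u uN) by rewrite ffunE.
exact: reach_im.
Qed.

Lemma starbit_reach d b c :
  starbit (@deg_reach k d) b c = (if d then b else c)%:R.
Proof.
rewrite /starbit /starval /deg_reach; congr (_%:R).
have -> : (if d then b else c) = (0 < (if d then b : nat else c))%N :> bool.
  by case: d; rewrite lt0b.
congr nat_of_bool; rewrite -star_reach; apply/forallP/idP => [//|h u].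
by have [->|/star_reach_im] := eqVneq u None.
Qed.

Lemma starbit_loose t b c : ~~ (b && c) ->
  starbit (@deg_loose k t) b c = if b || c then 0 else t.
Proof.
move=> bc; rewrite /starbit /starval /deg_loose.
set inc := remove_incl _.
have lN (u : J b c) : loose inc u -> u = None.
  case/looseP=> nu _; apply/eqP; apply: contraR nu; exact: star_reach_im.
have lE : loose inc None = ~~ (b || c).
  apply/looseP/idP => [[]|nbc].
    rewrite star_reach lt0b => nb iN; rewrite (negPf nb) /=; apply/negP=> cT.
    have c0 : (0 < c)%N by rewrite cT.
    by have := iN (Some (inr (Ordinal c0))); rewrite J_leE => /(_ isT).
  split; first by rewrite star_reach lt0b; apply: contra nbc => ->.
  case=> [[[i]|[i]]|] //; last first.
    by move: (i) nbc; case: c {bc inc lN} i => // i; rewrite orbT.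
  by move: nbc; case: b {bc inc lN} => //.
have -> : tame inc = ~~ (b || c).
  apply/tameP/idP => [/(_ None)|nbc u].
    rewrite lE !star_reach !lt0b => -[//|[bT cT]].
    by move: bc; rewrite bT cT.
  have [->|uN] := eqVneq u None; first by rewrite lE; left.
  by right; rewrite !star_reach_im.
case: ifP => bcE /=; rewrite ?mul0r ?mul1r //.
rewrite (_ : [set u | _] = [set None]) ?cards1 ?expr1 //.
apply/setP=> u; rewrite !inE; apply/idP/eqP => [/lN //|->].
by rewrite lE bcE.
Qed.

End StarValues.

Section Inversion.
Variables (k : fieldType) (nu kap : emb_rule k).
Hypotheses (nuP : is_measure nu) (kapP : is_degree kap).
Let nuM := measure_mult nuP.
Let kapM := degree_mult kapP.
Let VP := measure_valuation nuP.
Hypothesis fK : forall p q,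
  fval (starval nu) p q = starbit kap (0 < p)%N (0 < q)%N.

(** The preorders presenting the quotients of [s] in which [D] is still
    embedded. *)
Definition coarser (X : finType) (s : {set X * X}) (D : {set X}) :
  {set {set X * X}} :=
  [set r | [&& preo r, supp r == supp s, s \subset r
              & restr r D == restr s D]].

(** Points outside [D] are removed one at a time. For a point [x], the sum over
    the extensions of a given preorder by [x] depends only on whether [x] has
    points below it, and above it; this is also what determines the factor
    contributed by [x] to the degree function. *)
Lemma sum_coarser (X : finType) (s : {set X * X}) (D : {set X}) :
  preo s -> D \subset supp s ->
  \sum_(r in coarser s D) val_rule nu r D = val_rule kap s D.
Proof.
have [n] := ubnP #|supp s :\: D|; elim: n s => // n IHn s ltn ps Ds.
have [/eqP sD|/set0Pn[x]] := boolP (supp s :\: D == set0).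
  have {}sD : supp s = D.
    by apply/eqP; rewrite eqEsubset Ds andbT -setD_eq0 sD.
  have all1 : forall e, e \in supp s -> exists2 d, d \in D & eqv s e d.
    by move=> e es; exists e; rewrite -?sD // /eqv supp_refl.
  rewrite (val_equiv kapM ps all1) (_ : coarser s D = [set s]).
    by rewrite big_set1 (val_equiv nuM ps all1).
  apply/setP=> r; rewrite in_set in_set1; apply/and4P/eqP => [|->].
    case=> pr /eqP rs _ /eqP rr.
    by rewrite -(restr_id pr (_ : supp r \subset D)) ?rr ?restr_id // ?rs sD.
  by rewrite ps subxx.
case/setDP=> xs xD; pose E := supp s :\ x; pose s' := restr s E.
have ps' : preo s' := restr_preo E ps.
have s's : supp s' = E by rewrite supp_restr (setIidPr _) ?subD1set.
have sE : supp s = x |: E by rewrite setD1K.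
have DE : D \subset E by rewrite subsetD1 Ds.
have xE : x \notin E by rewrite !inE eqxx.
have rED r : restr (restr r E) D = restr r D by rewrite restr_restr (setIidPl DE).
pose A := [set y in E | (y, x) \in s]; pose B := [set y in E | (x, y) \in s].
transitivity (\sum_(r | [&& preo r, supp r == x |: E,
    restr r E \in coarser s' D, A \subset [set y | (y, x) \in r]
    & B \subset [set y | (x, y) \in r]]) val_rule nu r D).
  apply: eq_bigl => r; rewrite in_set [restr r E \in _]in_set s's sE rED rED.
  case pr: (preo r) => //=; have [rs|//] := eqVneq (supp r) (x |: E).
  rewrite restr_preo //= supp_restr rs (setIidPr _) ?subsetUr // eqxx /=.
  case: (restr r D == restr s D); rewrite ?andbF //= !andbT.
  apply/idP/and3P => [/subsetP sr|[/subsetP s'r /subsetP Ar /subsetP Br]].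
    split; apply/subsetP.
    - by move=> -[u v]; rewrite !restrE => /and3P[/sr -> -> ->].
    - by move=> y; rewrite !in_set => /andP[_ /sr].
    - by move=> y; rewrite !in_set => /andP[_ /sr].
  apply/subsetP=> -[u v] uv; have [us vs] := preo_supp ps uv.
  move: us vs uv; rewrite sE => /setU1P[->|uE] /setU1P[->|vE] uv.
  - by rewrite supp_refl // rs setU11.
  - by have := Br v; rewrite [v \in B]in_set vE uv inE; apply.
  - by have := Ar u; rewrite [u \in A]in_set uE uv inE; apply.
  - by have := s'r (u, v); rewrite !restrE uv uE vE => /(_ isT)/andP[].
rewrite (extsum_step VP _ _ xE DE) => [|r]; last first.
  by rewrite in_set s's => /and4P[-> /eqP -> _ _].
rewrite (val_mul kapM ps DE) -/s' (degree_val kapP ps xs).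
rewrite -(IHn s') ?s's //; last first.
  move: ltn; rewrite ltnS; apply: leq_trans; rewrite sE.
  rewrite [X in (_ < X)%N](cardsD1 x) in_setD xD setU11 add1n ltnS.
  apply/subset_leq_card/subsetP=> y /setDP[yE yD].
  rewrite in_setD1 in_setD in_setU1 yE yD orbT !andbT.
  by apply: contraNneq xE => <-.
rewrite mulr_suml; apply: eq_bigr => r; rewrite in_set.
case/and4P=> pr /eqP rs /subsetP s'r _; congr (_ * _).
have AE : A \subset E by apply/subsetP=> y; rewrite in_set => /andP[].
have BE : B \subset E by apply/subsetP=> y; rewrite in_set => /andP[].
have inE' y : (y \in E) && ((y, x) \in s) = (y != x) && ((y, x) \in s).
  rewrite in_setD1 -andbA; congr (_ && _); apply/andP/idP => [[]//|yx].
  by split=> //; case: (preo_supp ps yx).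
have inE2 y : (y \in E) && ((x, y) \in s) = (y != x) && ((x, y) \in s).
  rewrite in_setD1 -andbA; congr (_ && _); apply/andP/idP => [[]//|yx].
  by split=> //; case: (preo_supp ps yx).
rewrite (extsum_bits VP (starbit11 kapP) fK pr) ?rs ?s's //.
- congr (starbit kap _ _); apply/card_gt0P/existsP => -[y yx]; exists y.
  + by move: yx; rewrite in_set inE'.
  + by rewrite in_set inE'.
  + by move: yx; rewrite in_set inE2.
  + by rewrite in_set inE2.
- move=> a b; rewrite [a \in A]in_set [b \in B]in_set => /andP[aE ax] /andP[bE xb].
  by apply: s'r; rewrite restrE aE bE (preo_trans ps ax xb).
Qed.

End Inversion.

(** The identity [mobius_sum] says that the Moebius matrix is a left inverse of
    the zeta matrix; a left inverse of a square matrix is a right inverse. *)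
Lemma mobius_sum_up (T : poset) (x y : T) :
  \sum_(z | (x <= z)%O) mobius z y = (x == y)%:R.
Proof.
pose n := #|T|.
pose M : 'M[int]_n := \matrix_(i, j) mobius (enum_val i) (enum_val j).
pose Z : 'M[int]_n := \matrix_(i, j) (enum_val i <= enum_val j)%O%:R.
have MZ : M *m Z = 1%:M.
  apply/matrixP=> i j; rewrite !mxE; set u := enum_val i; set v := enum_val j.
  have -> : (i == j) = (u == v) by rewrite (inj_eq enum_val_inj).
  transitivity (\sum_(z | (u <= z <= v)%O) mobius u z).
    rewrite [RHS]big_mkcond [RHS](reindex (@enum_val _ predT)) /=; last first.
      exact/onW_bij/enum_val_bij.
    apply: eq_bigr => l _; rewrite !mxE -/u -/v.
    have [uz|uz] := boolP (u <= _)%O; last by rewrite mobius_out ?mul0r.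
    by case: (_ <= v)%O; rewrite ?mulr1 ?mulr0.
  have [->|uv] := eqVneq u v.
    rewrite (big_pred1 v) ?mobiusxx // => z.
    by rewrite /= -eq_le eq_sym.
  have [lt_uv|nuv] := boolP (u < v)%O; first exact: mobius_sum.
  rewrite big_pred0 // => z; apply/negP=> /andP[uz zv]; move: nuv.
  by rewrite lt_neqAle uv (le_trans uz zv).
have /matrixP/(_ (enum_rank x) (enum_rank y)) := mulmx1C MZ.
rewrite !mxE (inj_eq enum_rank_inj) => <-.
rewrite [LHS]big_mkcond [LHS](reindex (@enum_val _ predT)) /=; last first.
  exact/onW_bij/enum_val_bij.
apply: eq_bigr => l _; rewrite !mxE !enum_rankK.
by case: (x <= _)%O; rewrite ?mul1r ?mul0r.
Qed.

Section QuotientOrders.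
Variables (P Q : poset) (a : embedding P Q).
Variables (T : poset) (R : T -> quotient Q) (top : T).
Hypotheses (RQ : is_Quot R) (topQ : quot_iso (quot_id Q) (R top)).

(** Quotients of [Q] correspond to the preorders containing its order, and a
    smaller quotient to a larger preorder. *)
Definition qord (i : T) : {set Q * Q} := pullback_order (quot_map (R i)).
Definition pord (O : poset) : {set O * O} := [set u | (u.1 <= u.2)%O].
Notation D := [set a p | p in P].

Lemma qordE i x y :
  ((x, y) \in qord i) = (quot_map (R i) x <= quot_map (R i) y)%O.
Proof. by rewrite inE. Qed.

Lemma qord_preo i : preo (qord i).
Proof.
apply/preoP; split=> [x y _|y x z]; first by rewrite !inE /= !lexx.
rewrite !qordE; exact: le_trans.
Qed.

Lemma supp_qord i : supp (qord i) = setT.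
Proof. by apply/setP=> x; rewrite !inE /= lexx. Qed.

Lemma quot_iso_qord (R1 R2 : quotient Q) : quot_iso R1 R2 ->
  pullback_order (quot_map R1) = pullback_order (quot_map R2).
Proof.
case=> h [_ hE]; apply/setP=> -[x y].
by rewrite !inE /= -!hE emb_le.
Qed.

Lemma qord_top : qord top = pord Q.
Proof. by rewrite /qord -(quot_iso_qord topQ). Qed.

Lemma qord_le i j : (i <= j)%O = (qord j \subset qord i).
Proof. by apply/idP/idP => [/RQ.2/quot_le_pullback|/quot_le_pullback/RQ.2]. Qed.

Lemma qord_inj : injective qord.
Proof. by move=> i j e; apply/le_anti; rewrite !qord_le e subxx. Qed.

Lemma pord_sub i : pord Q \subset qord i.
Proof.
by apply/subsetP=> -[x y]; rewrite !inE; apply: quot_monotone.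
Qed.

Lemma le_top i : (i <= top)%O.
Proof. by rewrite qord_le qord_top pord_sub. Qed.

Lemma qord_surj r : preo r -> supp r = setT -> pord Q \subset r ->
  exists i, qord i = r.
Proof.
move=> pr rs /subsetP Qr; have [S [s sr]] := rep_exists pr.
have /fin_all_exists[g gE] (x : Q) : exists z, eqv r x (s z).
  by apply: sr.2; rewrite rs inE.
have rE x y : ((x, y) \in r) = (g x <= g y)%O.
  by rewrite (eqv_rel pr (gE x) (gE y)) sr.1.
have gM : monotone g by move=> x y xy; rewrite -rE; apply: Qr; rewrite inE.
have gS z : exists x, g x = z.
  by exists (s z); apply: (rep_inj sr); rewrite eqv_sym gE.
have [i iE] := RQ.1.2 (Defs.Quotient gM gS); exists i.
rewrite /qord -(quot_iso_qord iE); apply/setP=> -[x y].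
by rewrite inE rE.
Qed.

(** [P] is still embedded in the quotient of index [i]. *)
Definition keeps i := restr (qord i) D == restr (pord Q) D.

Lemma keepsP i : keeps i = is_embedding [ffun p => quot_map (R i) (a p)].
Proof.
apply/eqP/is_embeddingP => [e|[_ mono]].
  have le_a x y : (x <= y)%O = (quot_map (R i) (a x) <= quot_map (R i) (a y))%O.
    have /setP/(_ (a x, a y)) := e; rewrite !restrE !imset_f // !andbT qordE.
    by rewrite inE /= emb_le.
  split=> x y; rewrite !ffunE; last by rewrite -le_a.
  by move=> exy; apply/le_anti; rewrite !le_a exy lexx.
apply/setP=> -[u v]; rewrite !restrE.
case/boolP: (u \in D) => [/imsetP[x _ ->]|_]; last by rewrite !andbF.
case/boolP: (v \in D) => [/imsetP[y _ ->]|_]; last by rewrite !andbF.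
by rewrite !andbT qordE inE /= emb_le -mono !ffunE.
Qed.

Lemma extend0_keeps (k : fieldType) (nu : emb_rule k) i :
  is_compositional nu ->
  extend0 nu (fun p => quot_map (R i) (a p))
  = if keeps i then val_rule nu (qord i) D else 0.
Proof.
move=> nuM; rewrite keepsP; case: ifP => [ei|/negbT nei]; last first.
  rewrite extend0_out //; apply: contra nei => /is_embeddingP[inj mono].
  by apply/is_embeddingP; split=> x y; rewrite !ffunE //; apply: inj.
pose e := Embedding ei.
have -> : extend0 nu (fun p => quot_map (R i) (a p)) = extend0 nu e.
  by rewrite /extend0; congr oapp; congr insub; apply/ffunP=> x; rewrite !ffunE.
rewrite extend0_emb; apply/esym/(val_model nuM (qord_preo i)).
have /fin_all_exists[s sK] := @quot_surj _ (R i).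
exists s, a; split.
- split=> [u v|x _]; first by rewrite qordE !sK.
  by exists (quot_map (R i) x); rewrite /eqv !qordE !sK !lexx.
- split=> [x y|x].
    rewrite restrE !imset_f // !andbT qordE.
    by have := emb_le e x y; rewrite !ffunE.
  rewrite supp_restr => /setIP[_ /imsetP[p _ ->]]; exists p.
  by rewrite /eqv !restrE !imset_f // !andbT !qordE lexx.
- by move=> p; rewrite ffunE /eqv !qordE !sK !lexx.
Qed.

Lemma keeps_top : keeps top.
Proof. by rewrite /keeps qord_top. Qed.

Lemma val_top (k : fieldType) (nu : emb_rule k) : is_compositional nu ->
  val_rule nu (qord top) D = nu P Q a.
Proof.
move=> nuM; apply: (val_model nuM (qord_preo top)); rewrite qord_top.
exists id, a; split.
- by split=> [x y|x _]; [rewrite inE|exists x; rewrite /eqv !inE /= lexx].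
- split=> [x y|x]; first by rewrite restrE !imset_f // !andbT inE /= emb_le.
  rewrite supp_restr => /setIP[_ /imsetP[p _ ->]]; exists p.
  by rewrite /eqv !restrE !imset_f // !andbT !inE /= lexx.
- by move=> p; rewrite /eqv !inE /= lexx.
Qed.

Lemma keeps_le i j : (j <= i)%O -> keeps j -> keeps i.
Proof.
rewrite qord_le => /subsetP ij /eqP ej; apply/eqP/setP=> -[x y].
apply/idP/idP; last first.
  by rewrite !restrE => /and3P[xy -> ->]; rewrite (subsetP (pord_sub i)).
by rewrite -ej !restrE => /and3P[/ij -> -> ->].
Qed.

(** By [sum_coarser] the degree at a quotient [R i] is the sum of the measure
    over the quotients [R j] with [j <= i]; it is inverted by
    [mobius_sum_up]. *)
Lemma knop_inversion (k : fieldType) (nu kap : emb_rule k) :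
  is_measure nu -> is_degree kap ->
  (forall p q, fval (starval nu) p q = starbit kap (0 < p)%N (0 < q)%N) ->
  nu P Q a = \sum_(i : T) (mobius i top)%:~R *
                  extend0 kap (fun x => quot_map (R i) (a x)).
Proof.
move=> nuP kapP fK; have nuM := measure_mult nuP; have kapM := degree_mult kapP.
pose G i := if keeps i then val_rule nu (qord i) D else 0.
have KG i : extend0 kap (fun x => quot_map (R i) (a x)) = \sum_(j | (j <= i)%O) G j.
  rewrite extend0_keeps //; case: ifP => [ki|/negbT nki]; last first.
    rewrite big1 // => j ji; rewrite /G ifN //.
    by apply: contra nki; apply: keeps_le.
  rewrite -(sum_coarser nuP kapP fK (qord_preo i)) ?supp_qord ?subsetT //.
  have -> : coarser (qord i) D = qord @: [set j | (j <= i)%O && keeps j].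
    apply/setP=> r; rewrite in_set; apply/and4P/imsetP => [[pr /eqP rs ir /eqP rr]|].
      have [||j jr] := qord_surj pr; first by rewrite rs supp_qord.
        exact: subset_trans (pord_sub i) ir.
      exists j => //; rewrite in_set qord_le jr ir /keeps jr rr; exact: ki.
    case=> j; rewrite in_set qord_le => /andP[ji /eqP kj] ->.
    split=> //; rewrite ?qord_preo ?supp_qord // kj eq_sym; exact: ki.
  rewrite big_imset /=; last by move=> j l _ _; apply: qord_inj.
  rewrite (eq_bigl (fun j => (j <= i)%O && keeps j)) => [|j]; last by rewrite in_set.
  by rewrite big_mkcondr.
rewrite (eq_bigr _ (fun i _ => congr1 _ (KG i))).
rewrite (eq_bigr _ (fun i _ => mulr_sumr _ _ _ _)).
rewrite (exchange_big_dep predT) //=.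
transitivity (\sum_j ((j == top)%:R * G j)).
  rewrite (bigD1 top) //= eqxx mul1r big1 ?addr0 => [|j /negPf ->].
    by rewrite /G keeps_top val_top.
  by rewrite mul0r.
apply: eq_bigr => j _; rewrite -mulr_suml; congr (_ * _).
rewrite -[LHS](rmorph_nat (intr : {rmorphism int -> k})) -mobius_sum_up.
by rewrite rmorph_sum.
Qed.

End QuotientOrders.

(** * From an induced measure to its degree function *)

(** In a proper quotient of [J p q] where the other points are still embedded,
    the centre has fallen on one of them. Such a quotient is maximal among the
    proper ones, so its Moebius coefficient is -1, and the degree function is 1
    at it. *)
Section StarQuotients.
Variables (p q : nat) (T : poset) (R : T -> quotient (J p q)) (top : T).
Hypotheses (RQ : is_Quot R) (topQ : quot_iso (quot_id (J p q)) (R top)).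

Let X : finType := J p q.
Let o : X := star p q.
Let A : {set X} := [set Some (inl i) | i in 'I_p].
Let B : {set X} := [set Some (inr j) | j in 'I_q].
Let a := remove_incl (star p q).
Let D : {set X} := [set a u | u in (remove (star p q) : poset)].
Let s : {set X * X} := restr (pord (J p q)) D.

Let pordE (u v : J p q) : ((u, v) \in pord (J p q)) = (u <= v)%O.
Proof. by rewrite inE. Qed.

Let DE u : (u \in D) = (u != o).
Proof.
apply/imsetP/idP => [[v _ ->]|uo]; first by rewrite ffunE (valP v).
by exists (Sub u uo); rewrite // ffunE.
Qed.

Let DAB : D = A :|: B.
Proof.
apply/setP=> -[[i|j]|]; rewrite DE in_setU ?imset_f ?orbT //.
by apply/esym/norP; split; apply/imsetP=> -[].
Qed.

Let cA : #|A| = p. Proof. by rewrite card_imset ?card_ord // => i j [->]. Qed.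
Let cB : #|B| = q. Proof. by rewrite card_imset ?card_ord // => i j [->]. Qed.

Let ps : preo s.
Proof.
apply/restr_preo/preoP; split=> [x y _|y x z]; first by rewrite !inE /= !lexx.
by rewrite !pordE; apply: le_trans.
Qed.

Let ss : supp s = D.
Proof. by rewrite supp_restr; apply/setIidPr/subsetP=> u _; rewrite !inE /= lexx. Qed.

Let os : o \notin supp s. Proof. by rewrite ss DE eqxx. Qed.
Let sAB : supp s = A :|: B. Proof. by rewrite ss DAB. Qed.

Let sE u v : u != o -> v != o -> ((u, v) \in s) = (u <= v)%O.
Proof. by move=> uo vo; rewrite restrE !DE uo vo !andbT pordE. Qed.

Let Ach : antichain s A.
Proof.
by move=> _ _ /imsetP[i _ ->] /imsetP[j _ ->]; rewrite sE // J_leE orbF => /eqP.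
Qed.

Let Bch : antichain s B.
Proof.
by move=> _ _ /imsetP[i _ ->] /imsetP[j _ ->]; rewrite sE // J_leE orbF => /eqP.
Qed.

Let AB u v : u \in A -> v \in B -> (u, v) \in s.
Proof. by move=> /imsetP[i _ ->] /imsetP[j _ ->]; rewrite sE // J_leE. Qed.

Let BA u v : u \in A -> v \in B -> (v, u) \notin s.
Proof. by move=> /imsetP[i _ ->] /imsetP[j _ ->]; rewrite sE // J_leE. Qed.

Let pord_ext : pord (J p q) \in ext s o A B.
Proof.
have pp : preo (pord (J p q)).
  apply/preoP; split=> [x y _|y x z]; first by rewrite !inE /= !lexx.
  by rewrite !pordE; apply: le_trans.
apply/extP; split=> //; rewrite ?ss //.
- by apply/setP=> u; rewrite in_setU1 DE orbN !inE /= lexx.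
- by move=> _ /imsetP[i _ ->]; rewrite pordE J_leE.
- by move=> _ /imsetP[i _ ->]; rewrite pordE J_leE.
Qed.

Let pord_sub_ext r : r \in ext s o A B -> pord (J p q) \subset r.
Proof.
case/extP=> pr rs rr rA rB; apply/subsetP=> -[u v]; rewrite pordE => uv.
have allr w : w \in supp r by rewrite rs in_setU1 ss DE orbN.
have [e|uo] := eqVneq u o; have [e'|vo] := eqVneq v o.
- by rewrite e e' supp_refl.
- move: uv; rewrite e J_leE eq_sym (negPf vo) /=; case: v vo => [[i|j]|] //= _ _.
  by apply: rB; apply: imset_f.
- move: uv; rewrite e' J_leE (negPf uo) /=; case: u uo => [[i|j]|] //= _ _.
  by apply: rA; apply: imset_f.
- by rewrite -(restr_rel rr) ?ss ?DE // sE.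
Qed.

Let pord_jrel : pord (J p q) = jrel o A B.
Proof.
apply/eqP; rewrite eqEsubset pord_sub_ext ?(jrel_ext ps os sAB) //=.
apply/subsetP=> -[u v]; rewrite inE /= => /and3P[_ _ uv].
rewrite pordE J_leE; move: uv; rewrite /jrank.
have rk (w : J p q) : (if w \in B then 2%N else w == o) = J_rank w.
  case: w => [[i|j]|] //; last 2 first.
  - by rewrite imset_f.
  - by rewrite ifN ?eqxx //; apply/imsetP=> -[].
  by rewrite ifN //; apply/imsetP=> -[].
by rewrite !rk.
Qed.

Let keeps_ext i : keeps a R i -> qord R i \in ext s o A B.
Proof.
move=> /eqP ki; have [_ _ _ eA eB] := extP _ _ _ _ _ pord_ext.
apply/extP; split.
- exact: qord_preo.
- by rewrite supp_qord; apply/setP=> u; rewrite in_setU1 ss DE orbN inE.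
- by rewrite ss; exact: ki.
- by move=> u /eA /(subsetP (pord_sub R i)).
- by move=> u /eB /(subsetP (pord_sub R i)).
Qed.

Let ext_keeps r : r \in ext s o A B -> exists2 i, keeps a R i & qord R i = r.
Proof.
move=> rE; have [pr rs rr _ _] := extP _ _ _ _ _ rE.
have [||i ir] := qord_surj RQ pr; last 1 first.
- by exists i => //; apply/eqP; rewrite ir; move: rr; rewrite ss.
- by rewrite rs; apply/setP=> u; rewrite in_setU1 ss DE orbN inE.
exact: pord_sub_ext.
Qed.

Notation proper_keeps := [set i | (i != top) && keeps a R i].

Let proper_clone i : i \in proper_keeps ->
  exists2 y, y \in mids s A B & qord R i = clone o y s.
Proof.
rewrite in_set => /andP[itop /keeps_ext]; rewrite (ext_bip ps os sAB) //.
case/setU1P=> [e|/imsetP//]; case/eqP: itop; apply: (qord_inj RQ).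
by rewrite e -pord_jrel (qord_top topQ).
Qed.

Let card_proper : #|proper_keeps| = ((p == 1) + (q == 1))%N.
Proof.
transitivity #|mids s A B|; last by rewrite (mids_card sAB Ach Bch AB) // cA cB.
rewrite -(card_imset _ (qord_inj RQ)).
rewrite -(card_in_imset (clone_inj os sAB Ach Bch BA)).
apply: eq_card => r; apply/imsetP/imsetP => [[i iK ->]|[y ym ->]].
  by have [y ym ->] := proper_clone iK; exists y.
have := ym; case/midsP=> ys yA yB.
have cE : clone o y s \in ext s o A B.
  by rewrite (ext_bip ps os sAB) //; apply/setU1P; right; apply/imsetP; exists y.
have [i ki ic] := ext_keeps cE; exists i => //; rewrite in_set ki andbT.
apply: contraTneq ym => e; apply/negP=> ym.
have := mids_jrel os sAB AB BA ym.
by rewrite -ic e (qord_top topQ) pord_jrel eqxx.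
Qed.

Let mobius_proper i : i \in proper_keeps -> mobius i top = -1.
Proof.
move=> iK; have := iK; rewrite in_set => /andP[itop ki].
have lt_i : (i < top)%O by rewrite lt_neqAle itop (le_top RQ topQ).
have := mobius_sum lt_i; rewrite (bigD1 i) ?lexx ?(ltW lt_i) //=.
rewrite (bigD1 top) ?lexx ?(ltW lt_i) ?[top == i]eq_sym ?itop //=.
rewrite big1 => [|z /andP[/andP[/andP[iz _] zi] ztop]].
  by rewrite addr0 mobiusxx => /eqP; rewrite addrC addr_eq0 => /eqP.
have kz : keeps a R z by apply: keeps_le iz ki.
have zK : z \in proper_keeps by rewrite in_set ztop.
have [y ym yi] := proper_clone iK; have [y' ym' yz] := proper_clone zK.
case/eqP: zi; apply: (qord_inj RQ); rewrite yi yz.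
have /midsP[ys _ _] := ym; have /midsP[ys' _ _] := ym'.
have cE : clone o y s \in ext s o A B.
  by rewrite (ext_bip ps os sAB) //; apply/setU1P; right; apply/imsetP; exists y.
apply/esym/(ext_clone ps os ys' cE); move: iz; rewrite (qord_le RQ) yi yz.
move=> /subsetP zi; have := clone_eqv os ys'.
by rewrite /eqv => /andP[/zi -> /zi ->].
Qed.

Lemma star_induced (k : fieldType) (kap : emb_rule k) : is_degree kap ->
  \sum_(i : T) (mobius i top)%:~R *
     extend0 kap (fun x => quot_map (R i) (a x))
  = starval kap p q - (p == 1%N)%:R - (q == 1%N)%:R.
Proof.
move=> kapP; have kapM := degree_mult kapP.
rewrite (bigD1 top) //= mobiusxx mul1r (extend0_keeps a R top kapM).
rewrite (keeps_top a topQ) (val_top a topQ kapM) -/(starval kap p q).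
rewrite -addrA -opprD -natrD -card_proper; congr (_ + _).
rewrite -sumr_const -sumrN [RHS]big_mkcond [LHS]big_mkcond /=.
apply: eq_bigr => i _; rewrite in_set; case: eqP => //= /eqP itop.
rewrite (extend0_keeps a R i kapM); case: ifP => ki; last by rewrite mulr0.
have iK : i \in proper_keeps by rewrite in_set itop.
rewrite mobius_proper // (val_equiv kapM (qord_preo R i)) ?mulr1 //.
move=> e _; have [y ym iy] := proper_clone iK; have /midsP[ys _ _] := ym.
have [->|eo] := eqVneq e o.
  by exists y; [move: ys; rewrite ss|rewrite iy; apply: clone_eqv].
exists e; first by rewrite DE.
by rewrite /eqv supp_refl // supp_qord inE.
Qed.

End StarQuotients.

Lemma induced_fval (k : fieldType) (nu kap : emb_rule k) p q :
  is_degree kap -> induces kap nu ->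
  fval (starval nu) p q = starbit kap (0 < p)%N (0 < q)%N.
Proof.
move=> kapP ind; have [T [R RQ]] := Quot_exists (J p q).
have [top topQ] := RQ.1.2 (quot_id (J p q)).
rewrite /fval {1}/starval (ind _ _ _ _ _ _ RQ topQ) star_induced //.
by rewrite -(starval_bits kapP) addrAC subrK addrNK.
Qed.

Lemma knop_likeP (k : fieldType) (nu : emb_rule k) : is_measure nu ->
  knop_like nu <-> exists2 kap : emb_rule k, is_degree kap &
    forall p q, fval (starval nu) p q = starbit kap (0 < p)%N (0 < q)%N.
Proof.
move=> nuP; split=> [[kap [kapP ind]]|[kap kapP fK]].
  by exists kap => // p q; apply: induced_fval.
exists kap; split=> // P Q a T R top RQ topQ.
exact: knop_inversion.
Qed.

(** * The four families of matrices *)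

Lemma measure_matrixE (k : fieldType) (nu : emb_rule k) (i j : 'I_3) :
  measure_matrix nu i j = starval nu i j.
Proof. by rewrite mxE. Qed.

(** The matrix [K (0 < p) (0 < q) - (p == 1) - (q == 1)], for [K] with values
    [s], [u], [v], 1. *)
Definition bits_mx (k : fieldType) (s u v : k) : 'M[k]_3 :=
  mx_of_rows [:: [:: s;     v - 1; v];
                 [:: u - 1; -1;    0];
                 [:: u;     0;     1]].

Lemma measure_matrix_bits (k : fieldType) (nu : emb_rule k)
    (K : bool -> bool -> k) : K true true = 1 ->
  measure_matrix nu = bits_mx (K false false) (K true false) (K false true) <->
  forall p q, (p <= 2)%N -> (q <= 2)%N ->
    fval (starval nu) p q = K (0 < p)%N (0 < q)%N.
Proof.
move=> K1; set M := bits_mx _ _ _.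
have ME (i j : 'I_3) : M i j + (i == 1%N :> nat)%:R + (j == 1%N :> nat)%:R
    = K (0 < i)%N (0 < j)%N.
  rewrite mxE; case: i j => [[|[|[|]]] //= _] [[|[|[|]]] //= _];
  by rewrite ?mulr0n ?mulr1n ?addr0 ?subrK ?addNr ?add0r ?K1.
split=> [/matrixP N p q p2 q2|fK].
  have := ME (inord p) (inord q); rewrite -N measure_matrixE !inordK //.
apply/matrixP=> i j; rewrite measure_matrixE.
apply/(addIr (i == 1%N :> nat)%:R)/(addIr (j == 1%N :> nat)%:R).
by rewrite ME -fK // -ltnS ltn_ord.
Qed.

Lemma bits_mx_B5 (k : fieldType) (t : k) : bits_mx t 0 0 = B5 t.
Proof. by rewrite /bits_mx sub0r. Qed.

Lemma bits_mx_C7 (k : fieldType) : bits_mx 0 1 0 = C7 k.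
Proof. by rewrite /bits_mx sub0r subrr. Qed.

Lemma bits_mx_C7_tr (k : fieldType) : bits_mx 0 0 1 = (C7 k)^T.
Proof.
rewrite /bits_mx sub0r subrr; apply/matrixP=> i j; rewrite !mxE.
by case: i j => [[|[|[|]]] //= _] [[|[|[|]]] //= _].
Qed.

Lemma bits_mx_C8 (k : fieldType) : bits_mx 1 1 1 = C8 k.
Proof. by rewrite /bits_mx subrr. Qed.

Lemma knop_like_bits (k : fieldType) (nu kap : emb_rule k) : is_measure nu ->
  is_degree kap -> measure_matrix nu =
    bits_mx (starbit kap false false) (starbit kap true false)
            (starbit kap false true) -> knop_like nu.
Proof.
move=> nuP kapP N; have K1 := starbit11 kapP.
apply/(knop_likeP nuP); exists kap => //.
apply: (fval_bits (measure_valuation nuP) K1).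
exact/(measure_matrix_bits nu K1).
Qed.

Theorem mainTheorem13 (k : fieldType) (nu : emb_rule k) (Hnu : is_measure nu) :
  knop_like nu <->
    [\/ exists t : k, measure_matrix nu = B5 t,
        measure_matrix nu = C7 k,
        measure_matrix nu = (C7 k)^T
      | measure_matrix nu = C8 k].
Proof.
split=> [/(knop_likeP Hnu)[kap kapP fK]|].
  have /(measure_matrix_bits nu (starbit11 kapP)) : forall p q, (p <= 2)%N ->
      (q <= 2)%N -> fval (starval nu) p q = starbit kap (0 < p)%N (0 < q)%N.
    by move=> p q _ _; apply: fK.
  have [] := starbit_relations kapP.
  set s := starbit kap false false; set u := starbit kap true false.
  set v := starbit kap false true => uu vv su sv ->.
  have idem (w : k) : w * w = w -> w = 0 \/ w = 1.
    move=> ww; have [->|w0] := eqVneq w 0; first by left.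
    by right; apply: (mulfI w0); rewrite ww mulr1.
  case: (idem u uu) (idem v vv) su sv => [->|->] [->|->];
    rewrite ?mulr0 ?mulr1.
  - by move=> _ _; constructor 1; exists s; rewrite bits_mx_B5.
  - by move=> _ ->; constructor 3; rewrite bits_mx_C7_tr.
  - by move=> -> _; constructor 2; rewrite bits_mx_C7.
  - by move=> -> _; constructor 4; rewrite bits_mx_C8.
case=> [[t] | | | ] N.
- apply: (knop_like_bits Hnu (deg_loose_degree t)).
  by rewrite !starbit_loose // bits_mx_B5.
- apply: (knop_like_bits Hnu (deg_reach_degree k true)).
  by rewrite !starbit_reach bits_mx_C7.
- apply: (knop_like_bits Hnu (deg_reach_degree k false)).
  by rewrite !starbit_reach bits_mx_C7_tr.
- apply: (knop_like_bits Hnu (deg_one_degree k)).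
  by rewrite /starbit /starval /deg_one bits_mx_C8.
Qed.
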